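(* Let $\Omega\subset\mathbb{R}^n$ be a bounded domain with smooth and strictly convex boundary, let $K$ be a smooth function on an open subset of $\mathbb{R}^n$ containing $\overline\Omega$ with $K\ge k_o$ for some constant $k_o>0$, and let $\varphi$ be a smooth strictly convex function on an open subset of $\mathbb{R}^n$ containing $\overline\Omega$. Let $u$ be a smooth strictly convex function in $\Omega$ solving the Abreu equation $\mathcal{S}(u)=K$ in $\Omega$ with $u=\varphi$, $|\nabla u|=\infty$ and $w=\det(D^2u)^{-1}=0$ on $\partial\Omega$. Then the Legendre transform $f$ of $u$ yields (as a potential function defined on all of $\mathbb{R}^n$) a Kähler metric of scalar curvature $K$ on the complex torus $\mathbb{C}^n/2\pi\sqrt{-1}\,\mathbb{Z}^n$. In particular, if $K$ is constant, one obtains a $T^n$-invariant Kähler metric of constant scalar curvature $K$ on $\mathbb{C}^n/2\pi\sqrt{-1}\,\mathbb{Z}^n$.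
   Context: Coordinates on $\Omega$ are $\xi=(\xi_1,\dots,\xi_n)$. Smooth strictly convex functions have positive definite Hessian; a smooth boundary is strictly convex if all its principal curvatures are positive. For smooth strictly convex $u$ with inverse Hessian $(u^{ij})$, $\mathcal{S}(u)=-\sum_{i,j}\frac{\partial^2u^{ij}}{\partial\xi_i\partial\xi_j}$. The boundary conditions on $u$ are understood as limits as $\xi\in\Omega$ tends to any boundary point. The Legendre transform $f$ of $u$ is the function on $\nabla u(\Omega)$ given by $f(x)=\sum_k\xi_k\frac{\partial u}{\partial\xi_k}-u(\xi)$, where $x=\nabla u(\xi)$. On $\mathbb{C}^n/2\pi\sqrt{-1}\,\mathbb{Z}^n\cong(\mathbb{C}^* )^n$ use coordinates $z_k=x_k+\sqrt{-1}\,\theta_k$; the torus $T^n$ acts by translations in $\theta$. The metric with potential $f$ is $g_{i\bar j}=\frac{\partial^2 f(x)}{\partial z_i\partial\bar z_j}$, with $f$ regarded as a function of $x=\mathrm{Re}\,z$. Scalar curvature is normalized as $-\sum g^{i\bar j}\frac{\partial^2}{\partial z_i\partial\bar z_j}\log\det(g_{k\bar l})$, which equals $-\sum_{i,j}f^{ij}\frac{\partial^2}{\partial x_i\partial x_j}\log\det(f_{kl})$, and ''scalar curvature $K$'' means that at a point with real part $x=\nabla u(\xi)$ it equals $K(\xi)$. *)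

(* Defs.v *)
From HB Require Import structures.
From mathcomp Require Import all_boot all_order all_algebra.
From mathcomp Require Import complex.
From mathcomp Require Import all_classical all_reals all_analysis.

Set Implicit Arguments.
Unset Strict Implicit.
Unset Printing Implicit Defensive.

Import Order.TTheory GRing.Theory Num.Theory.
Import numFieldNormedType.Exports.

Local Open Scope classical_set_scope.
Local Open Scope ring_scope.
Local Open Scope complex_scope.

Section RealCalculus.
Variables (R : realType) (n : nat).
Implicit Types (x v p : 'rV[R]_n) (f u rho : 'rV[R]_n -> R) (U V Omega : set 'rV[R]_n).

Definition dot x v : R := \sum_i x 0 i * v 0 i.

(* The library norm on row vectors is the sup norm, hence a separate
   Euclidean norm. *)
Definition enorm x : R := Num.sqrt (dot x x).

Definition partial (i : 'I_n) f : 'rV[R]_n -> R :=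
  fun x => 'D_(delta_mx 0 i) f x.

Definition partials (s : seq 'I_n) f : 'rV[R]_n -> R := foldr partial f s.

(* Meaningful for open U only, in which case it does not depend on the values
   of f outside U. *)
Definition smooth_on U f :=
  forall s x, U x -> differentiable (partials s f) x.

Definition grad f x : 'rV[R]_n := \row_i partial i f x.

Definition hess f x : 'M[R]_n := \matrix_(i, j) partial i (partial j f) x.

Definition strictly_convex_on U f :=
  forall x, U x -> forall v, v != 0 -> 0 < (v *m hess f x *m v^T) 0 0.

Definition abreu u x : R :=
  - \sum_i \sum_j partial i (partial j (fun y => invmx (hess u y) i j)) x.

Definition boundary Omega : set 'rV[R]_n := closure Omega `\` interior Omega.

Definition bounded_domain Omega :=
  [/\ open Omega, connected Omega, Omega !=set0 & bounded_set Omega].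

Definition local_defining_function Omega p V rho :=
  [/\ open V, V p, smooth_on V rho, (forall x, V x -> grad rho x != 0)
    & Omega `&` V = [set x | rho x < 0] `&` V].

Definition smooth_boundary Omega :=
  forall p, boundary Omega p ->
  exists V rho, local_defining_function Omega p V rho.

(* Outward unit normal field of the level sets of a defining function. *)
Definition unit_normal rho x : 'rV[R]_n := (enorm (grad rho x))^-1 *: grad rho x.

(* Principal curvatures are the eigenvalues of the differential of the outward
   unit normal on the tangent space; with this sign those of a ball of radius
   r equal 1 / r. *)
Definition principal_curvature Omega p (kappa : R) :=
  exists V rho v, [/\ local_defining_function Omega p V rho,
    v != 0, dot v (unit_normal rho p) = 0
    & 'D_v (unit_normal rho) p = kappa *: v].

Definition smooth_strictly_convex_boundary Omega :=
  smooth_boundary Omega /\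
  forall p, boundary Omega p ->
  forall kappa, principal_curvature Omega p kappa -> 0 < kappa.

(* The value is meaningful at x in the image of Omega under grad u, provided
   the right-hand side does not depend on the preimage xi; 0 elsewhere. *)
Definition legendre Omega u x : R :=
  xget 0 [set y | exists xi, [/\ Omega xi, grad u xi = x & y = dot xi x - u xi]].

End RealCalculus.

(* C^n is R^(n + n) with z = row_mx x theta standing for x + i theta, so that
   lshift n k indexes x_k and rshift n k indexes theta_k. *)
Section ComplexCalculus.
Variables (R : realType) (n : nat).
Implicit Types (z w : 'rV[R]_(n + n)) (F : 'rV[R]_(n + n) -> R[i]).
Implicit Types (g : 'rV[R]_(n + n) -> 'M[R[i]]_n).

Definition cpartial (k : 'I_(n + n)) F z : R[i] :=
  partial k (fun w => complex.Re (F w)) z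
    +i* partial k (fun w => complex.Im (F w)) z.

Definition dz (k : 'I_n) F z : R[i] :=
  2^-1 * (cpartial (lshift n k) F z - 'i * cpartial (rshift n k) F z).

Definition dzbar (k : 'I_n) F z : R[i] :=
  2^-1 * (cpartial (lshift n k) F z + 'i * cpartial (rshift n k) F z).

Definition csmooth F :=
  smooth_on [set: 'rV[R]_(n + n)] (fun w => complex.Re (F w)) /\
  smooth_on [set: 'rV[R]_(n + n)] (fun w => complex.Im (F w)).

(* g z i j stands for g_{i \bar j}(z). Tensors on the quotient of C^n by
   2 pi i Z^n are the periodic tensors on C^n. The last two clauses are the
   (2,1) and (1,2) components of d omega = 0, where omega is the
   fundamental form of g. *)
Definition kahler_metric_torus g :=
  (forall i j, csmooth (fun z => g z i j)) /\
  (forall z (m : 'I_n -> int),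
     g (z + row_mx 0 (\row_k (2 * pi * (m k)%:~R))) = g z) /\
  (forall z, (map_mx Num.conj (g z))^T = g z) /\
  (forall z (v : 'rV[R[i]]_n), v != 0 ->
     0 < (v *m g z *m (map_mx Num.conj v)^T) 0 0) /\
  (forall z i j k, dz k (fun w => g w i j) z = dz i (fun w => g w k j) z) /\
  (forall z i j k, dzbar k (fun w => g w i j) z = dzbar j (fun w => g w i k) z).

Definition torus_invariant g :=
  forall z (t : 'rV[R]_n), g (z + row_mx 0 t) = g z.

Definition potential_metric (f : 'rV[R]_n -> R) z : 'M[R[i]]_n :=
  \matrix_(i, j) dz i (dzbar j (fun w => (f (lsubmx w))%:C)) z.

(* The indices of the inverse matrix are swapped because g^{i \bar j} is
   determined by \sum_j g^{i \bar j} g_{k \bar j} = delta_{ik}. The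
   determinant of a Hermitian matrix is real, so taking its real part loses
   nothing. *)
Definition scalar_curvature g z : R[i] :=
  - \sum_i \sum_j invmx (g z) j i *
      dz i (dzbar j (fun w => (ln (complex.Re (\det (g w))))%:C)) z.

End ComplexCalculus.

(* Main.v *)
(** Positive principal curvatures make [Omega] convex, so [grad u] is strictly
    monotone, hence injective, on [Omega].  Its range is open, because for [x]
    close to a value of the gradient [xi . x - u xi] has an interior maximum on
    small balls, and closed, because [Omega] is bounded and [|grad u|] blows up
    at the boundary; so [grad u] is a bijection onto [R^n].  Its inverse [G] is
    continuous, hence differentiable with Jacobian [(D^2 u)^-1 o G], which
    bootstraps to smoothness.  The Legendre transform [f] satisfies
    [grad f = G] and [D^2 f = (D^2 u)^-1 o G], and Jacobi's formula gives
    [d_j log det D^2 f = (\sum_k d_k u^jk) o G]; a second differentiation turns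
    [\sum f^ij d_i d_j log det D^2 f] into [(\sum d_i d_j u^ij) o G], that is,
    the scalar curvature of [f] at [grad u xi] into the Abreu operator of [u]
    at [xi].  For a potential [f (Re z)], [d/dz] and [d/dzbar] are both half
    of [d/dx]. *)

Require Import Defs.
From mathcomp Require Import all_boot all_order all_algebra.
From mathcomp Require Import complex polyrcf perm.
From mathcomp Require Import all_classical all_reals all_analysis.
From mathcomp Require Import ring lra.

Set Implicit Arguments.
Unset Strict Implicit.
Unset Printing Implicit Defensive.

Import Order.TTheory GRing.Theory Num.Theory.
Import numFieldNormedType.Exports.

Local Open Scope classical_set_scope.
Local Open Scope ring_scope.
Local Open Scope complex_scope.

(** * Directional derivatives *)

Section DerivativeAlongLine.
Variables (R : realType) (V V' W : normedModType R) (f : V -> W) (g : V' -> W).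
Variables (x v : V) (x' v' : V').
Hypothesis fg : forall t : R, f (t *: v + x) = g (t *: v' + x').

Lemma eq_line_growth_rate :
  (fun t : R => t^-1 *: ((f \o shift x) (t *: v) - f x)) =
  (fun t : R => t^-1 *: ((g \o shift x') (t *: v') - g x')).
Proof.
have fgx : f x = g x' by have := fg 0; rewrite !scale0r !add0r.
by apply/funext => t; rewrite /shift /= fg fgx.
Qed.

Lemma eq_line_derive : 'D_v f x = 'D_v' g x'.
Proof. by rewrite /derive eq_line_growth_rate. Qed.

Lemma eq_line_is_derive d : is_derive x v f d -> is_derive x' v' g d.
Proof. by move=> [df <-]; split; move: df; rewrite /derivable /derive eq_line_growth_rate. Qed.

End DerivativeAlongLine.

Section DirectionalDerivative.
Variables (R : realType) (V : normedModType R).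
Implicit Types (f : V -> R) (x v w : V).

Lemma near_line x v (P : set V) :
  (\forall y \near x, P y) -> \forall t \near (0 : R), P (x + t *: v).
Proof.
move=> nP; have : x + t *: v @[t --> (0 : R)] --> x.
  rewrite -[X in _ --> X]addr0 -(scale0r v).
  by apply: cvgD; [exact: cvg_cst | apply: cvgZr_tmp; exact: cvg_id].
exact.
Qed.

Lemma near_segment0 (P : set R) : (\forall t \near 0, P t) ->
  \forall h \near 0^'+, forall t, 0 <= t <= h -> P t.
Proof.
move=> /nbhs_ballP[e /= e0 eP]; near=> h.
have he : h < e by near: h; exact: nbhs_right_lt.
move=> t /andP[t0 th]; apply: eP.
by rewrite /ball /= sub0r normrN ger0_norm // (le_lt_trans th).
Unshelve. all: by end_near. Qed.

Lemma near_parallelogram0 x v w (P : set V) : (\forall y \near x, P y) ->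
  \forall h \near (0 : R)^'+, forall s t, 0 <= s <= h -> 0 <= t <= h ->
    P (x + s *: v + t *: w).
Proof.
move=> nP.
have cxy : x + p.1 *: v + p.2 *: w @[p --> nbhs (0 : R, 0 : R)] --> x.
  rewrite -[X in _ --> X]addr0 -(scale0r w); apply: cvgD.
    rewrite -[X in _ --> X]addr0 -(scale0r v); apply: cvgD; first exact: cvg_cst.
    by apply: cvgZr_tmp; exact: cvg_fst.
  by apply: cvgZr_tmp; exact: cvg_snd.
have [[A B] /= [nA nB] AB] := cxy _ nP.
have := near_segment0 nB; have := near_segment0 nA; apply: filterS2 => h hA hB s t sh th.
by apply: (AB (s, t)); split; [exact: hA | exact: hB].
Qed.

Lemma is_derive_lineP (W : normedModType R) (f : V -> W) x v (t : R) d :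
  is_derive (x + t *: v) v f d <-> is_derive t 1 (fun s => f (x + s *: v)) d.
Proof.
have lineE h : f (h *: v + (x + t *: v)) = f (x + (h *: 1 + t) *: v).
  by rewrite [h *: 1]mulr1 scalerDl addrCA.
by split; apply: eq_line_is_derive => h; rewrite lineE.
Qed.

Lemma is_derive_line (W : normedModType R) (f : V -> W) x v (t : R) :
  derivable f (x + t *: v) v ->
  is_derive t 1 (fun s => f (x + s *: v)) ('D_v f (x + t *: v)).
Proof. by move=> /derivableP /is_derive_lineP. Qed.

Lemma is_derive_comp1 f (g : R -> R) x v (df dg : R) :
  is_derive (f x) 1 g dg -> is_derive x v f df ->
  is_derive x v (fun y => g (f y)) (dg * df).
Proof.
move=> dgE dfE; rewrite -[x]addr0 -(scale0r v); apply/is_derive_lineP.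
apply: (@is_derive1_comp R g (fun s => f (x + s *: v))).
  by rewrite scale0r addr0.
by apply/is_derive_lineP; rewrite scale0r addr0.
Qed.

Lemma is_derive_translate f a x v d : is_derive (x + a) v f d ->
  is_derive x v (fun y => f (y + a)) d.
Proof. by apply: eq_line_is_derive => t; rewrite addrA. Qed.

Lemma MVT_line f x v (h : R) : 0 < h ->
  (forall t, 0 <= t <= h -> derivable f (x + t *: v) v) ->
  exists2 t, 0 < t < h & f (x + h *: v) - f x = h * 'D_v f (x + t *: v).
Proof.
move=> h0 df; pose phi s := f (x + s *: v).
have dphi t : 0 <= t <= h -> is_derive t 1 phi ('D_v f (x + t *: v)).
  by move=> /df; exact: is_derive_line.
have [||t] := @MVT R phi (fun t => 'D_v f (x + t *: v)) 0 h h0.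
- by move=> t; rewrite in_itv /= => /andP[/ltW t0 /ltW th]; apply: dphi; rewrite t0 th.
- apply: derivable_within_continuous => t; rewrite in_itv /= => th.
  by have [] := dphi _ th.
by rewrite in_itv /= /phi scale0r addr0 subr0 mulrC => th fE; exists t.
Qed.

Lemma derive_line_max f x v : (\forall y \near x, derivable f y v) ->
  (\forall t \near (0 : R), f (x + t *: v) <= f x) -> 'D_v f x = 0.
Proof.
move=> /(near_line v) df fmax.
have /nbhs_ballP[e /= e0 eP] :
    nbhs 0 [set t : R | derivable f (x + t *: v) v /\ f (x + t *: v) <= f x].
  exact: filterI.
have mem_ball0 (t : R) : t \in `]- e, e[%R -> ball 0 e t.
  by rewrite in_itv /ball /= sub0r normrN ltr_norml.
have [] : is_derive (0 : R) 1 (fun t => f (x + t *: v)) 0.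
  apply: (@derive1_at_max _ _ (- e) e).
  - by rewrite (le_trans _ (ltW e0)) // oppr_le0 ltW.
  - by move=> t /mem_ball0/eP[/is_derive_line[]].
  - by rewrite in_itv /= oppr_lt0 e0.
  - by move=> t /mem_ball0/eP[_]; rewrite scale0r addr0.
move=> _ <-; apply/esym; apply: derive_val; apply/is_derive_lineP.
by rewrite scale0r addr0; apply: derivableP; have := nbhs_singleton df; rewrite scale0r addr0.
Qed.

Lemma derive2_line_max f x v : (\forall y \near x, derivable f y v) ->
  derivable ('D_v f) x v -> (\forall t \near (0 : R), f (x + t *: v) <= f x) ->
  'D_v ('D_v f) x <= 0.
Proof.
move=> df d2f fmax; rewrite leNgt; apply/negP => d2f0.
have Df0 := derive_line_max df fmax.
have slope : h^-1 *: ('D_v f (h *: v + x) - 'D_v f x) @[h --> (0 : R)^'+] -->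
    'D_v ('D_v f) x by exact: cvg_dnbhs_at_right.
have Dpos : \forall t \near (0 : R)^'+, 0 < 'D_v f (x + t *: v).
  near=> t; have : 0 < t^-1 *: ('D_v f (t *: v + x) - 'D_v f x).
    by near: t; exact: (cvgr_gt _ slope).
  rewrite Df0 subr0 addrC /GRing.scale /= pmulr_rgt0 // invr_gt0.
  by near: t; exact: nbhs_right_gt.
near ((0 : R)^'+) => h; have h0 : 0 < h by near: h; exact: nbhs_right_gt.
have segmentP : forall t, 0 <= t <= h -> [/\ derivable f (x + t *: v) v, f (x + t *: v) <= f x
    & 0 < t -> 0 < 'D_v f (x + t *: v)].
  near: h; apply: near_segment0; near=> t; split.
  - by near: t; exact: (near_line v df).
  - by near: t.
  - by near: t; move: Dpos; rewrite near_withinE.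
have [t th|t /andP[t0 /ltW th] fhE] := @MVT_line f x v h h0; first by have [] := segmentP t th.
have [|_ + _] := segmentP h; first by rewrite lexx ltW.
rewrite leNgt -subr_gt0 fhE mulr_gt0 //.
by have [|_ _] := segmentP t; [rewrite ltW | exact].
Unshelve. all: by end_near. Qed.

Definition second_difference f x v w (h : R) :=
  f (x + h *: v + h *: w) - f (x + h *: v) - (f (x + h *: w) - f x).

Lemma second_differenceC f x v w : second_difference f x v w = second_difference f x w v.
Proof. by apply/funext => h; rewrite /second_difference (addrAC x); ring. Qed.

Lemma MVT_second_difference f x v w (h : R) : 0 < h ->
  (forall s t, 0 <= s <= h -> 0 <= t <= h ->
    derivable f (x + s *: v + t *: w) v /\ derivable ('D_v f) (x + s *: v + t *: w) w) ->
  exists s t, [/\ 0 <= s <= h, 0 <= t <= h &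
    second_difference f x v w h = h ^+ 2 * 'D_w ('D_v f) (x + s *: v + t *: w)].
Proof.
move=> h0 dvw; pose g y := f (y + h *: w) - f y.
have h_in : 0 <= h <= h by rewrite lexx ltW.
have zero_in : 0 <= (0 : R) <= h by rewrite lexx ltW.
have dg s : 0 <= s <= h -> is_derive (x + s *: v) v g
    ('D_v f (x + s *: v + h *: w) - 'D_v f (x + s *: v)).
  move=> sh; apply: is_deriveB.
    have [df _] := dvw s h sh h_in; exact: is_derive_translate (derivableP df).
  by apply: derivableP; have [] := dvw s 0 sh zero_in; rewrite scale0r addr0.
have [s /dg[]//|s /andP[/ltW s0 /ltW sh] gE] := @MVT_line g x v h h0.
have {}sh : 0 <= s <= h by rewrite s0.
have [t th|t /andP[/ltW t0 /ltW th] DvE] := @MVT_line ('D_v f) (x + s *: v) w h h0.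
  by have [] := dvw s t sh th.
exists s, t; split=> //; first by rewrite t0.
by have [_ DgE] := dg s sh; rewrite [LHS]gE DgE DvE mulrA.
Qed.

Lemma cvg_second_difference f x v w :
  (\forall y \near x, derivable f y v /\ derivable ('D_v f) y w) ->
  {for x, continuous ('D_w ('D_v f))} ->
  h^-2 * second_difference f x v w h @[h --> (0 : R)^'+] --> 'D_w ('D_v f) x.
Proof.
move=> dvw cvw; apply/cvgrPdist_lt => e e0.
have near_e : \forall y \near x, `|'D_w ('D_v f) x - 'D_w ('D_v f) y| < e.
  exact: ((cvgrPdist_lt _ _).1 cvw e e0).
near=> h; have h0 : 0 < h by near: h; exact: nbhs_right_gt.
have [|s [t [sh th ->]]] := @MVT_second_difference f x v w h h0.
  by near: h; exact: (near_parallelogram0 v w dvw).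
rewrite mulKf ?expf_neq0 ?gt_eqF //; move: s t sh th.
by near: h; exact: (near_parallelogram0 v w near_e).
Unshelve. all: by end_near. Qed.

Lemma deriveC f x v w :
  (\forall y \near x, derivable f y v /\ derivable ('D_v f) y w) ->
  (\forall y \near x, derivable f y w /\ derivable ('D_w f) y v) ->
  {for x, continuous ('D_w ('D_v f))} -> {for x, continuous ('D_v ('D_w f))} ->
  'D_w ('D_v f) x = 'D_v ('D_w f) x.
Proof.
move=> dvw dwv cvw cwv.
rewrite -(cvg_lim (@norm_hausdorff _ _) (cvg_second_difference dvw cvw)).
by rewrite second_differenceC (cvg_lim (@norm_hausdorff _ _) (cvg_second_difference dwv cwv)).
Qed.

End DirectionalDerivative.

(** * Matrix-valued functions *)

(* Both sides are the sum over [i] of the determinant of [A] with row [i] taken from [B]. *)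
Lemma mxtrace_adj_mul (R : comNzRingType) (n : nat) (A B : 'M[R]_n) :
  \tr (\adj A *m B) =
  \sum_(s : 'S_n) (-1) ^+ s * \sum_i B i (s i) * \prod_(j | j != i) A j (s j).
Proof.
pose Ai (i : 'I_n) := \matrix_(a, b) (if a == i then B i b else A a b).
transitivity (\sum_i \det (Ai i)).
  rewrite mxtrace_mulC; apply: eq_bigr => i _.
  rewrite (expand_det_row _ i) mxE; apply: eq_bigr => j _; rewrite !mxE eqxx.
  congr (_ * _); rewrite /cofactor; congr (_ * \det _).
  by apply/matrixP => a b; rewrite !mxE eq_sym (negbTE (neq_lift _ _)).
rewrite exchange_big /=; apply: eq_bigr => s _; rewrite mulr_sumr.
apply: eq_bigr => i _; congr (_ * _); rewrite (bigD1 i) //= mxE eqxx; congr (_ * _).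
by apply: eq_bigr => j ji; rewrite mxE (negbTE ji).
Qed.

Section DerivativeRules.
Variables (R : realType) (V : normedModType R).
Implicit Types (x v : V).

Lemma is_derive_bigsum (W : normedModType R) (I : Type) (r : seq I) (P : pred I)
    (F : I -> V -> W) (dF : I -> W) x v :
  (forall i, P i -> is_derive x v (F i) (dF i)) ->
  is_derive x v (fun y => \sum_(i <- r | P i) F i y) (\sum_(i <- r | P i) dF i).
Proof.
move=> FdF; rewrite -fct_sumE.
elim/big_rec2: _ => [|i df f Pi fdf]; first exact: is_derive_cst.
exact: is_deriveD (FdF i Pi) fdf.
Qed.

Lemma is_derive_bigprod (I : eqType) (r : seq I) (F : I -> V -> R) (dF : I -> R) x v :
  uniq r -> (forall i, is_derive x v (F i) (dF i)) ->
  is_derive x v (fun y => \prod_(i <- r) F i y)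
    (\sum_(i <- r) dF i * \prod_(j <- r | j != i) F j x).
Proof.
move=> + FdF; elim: r => [_|i r IHr /= /andP[ir /IHr{}IHr]].
  rewrite big_nil (_ : (fun _ => _) = cst 1); first exact: is_derive_cst.
  by apply/funext => y; rewrite big_nil.
rewrite (_ : (fun _ => _) = F i * (fun y => \prod_(j <- r) F j y)); last first.
  by apply/funext => y; rewrite big_cons.
apply: is_derive_eq; rewrite !big_cons eqxx addrC /= [in LHS]/GRing.scale /= mulrC.
congr (_ * _ + _).
  rewrite [LHS]big_seq [RHS]big_seq_cond; apply: eq_bigl => j.
  by have [jr|//] := boolP (j \in r); apply/esym; apply: contraNneq ir => <-.
rewrite mulr_sumr [LHS]big_seq [RHS]big_seq; apply: eq_bigr => j jr.
by rewrite big_cons ifT 1?mulrCA //; apply: contraNneq ir => ->.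
Qed.

Lemma is_derive_mxP m n (M : V -> 'M[R]_(m, n)) dM x v :
  is_derive x v M dM <-> forall i j, is_derive x v (fun y => M y i j) (dM i j).
Proof.
split=> [[MdM <-] i j|MdM].
  by split; [exact: (derivable_mxP _ _ _).1 | rewrite derive_mx // mxE].
have dM' : derivable M x v by apply/derivable_mxP => i j; case: (MdM i j).
split => //; rewrite derive_mx //; apply/matrixP => i j.
by rewrite mxE; case: (MdM i j).
Qed.

Lemma is_derive_mulmx m n p (M : V -> 'M[R]_(m, n)) (N : V -> 'M[R]_(n, p)) dM dN x v :
  is_derive x v M dM -> is_derive x v N dN ->
  is_derive x v (fun y => M y *m N y) (dM *m N x + M x *m dN).
Proof.
move=> /is_derive_mxP MdM /is_derive_mxP NdN; apply/is_derive_mxP => i j.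
rewrite (_ : (fun y => _) = fun y => \sum_k ((fun z => M z i k) * (fun z => N z k j)) y);
  last first.
  by apply/funext => y; rewrite mxE.
apply: is_derive_eq; first by apply: is_derive_bigsum => k _; exact: is_deriveM.
rewrite !mxE -big_split; apply: eq_bigr => k _ /=.
by rewrite addrC; congr (_ + _); rewrite mulrC.
Qed.

Lemma is_derive_dot n (f g : V -> 'rV[R]_n) df dg x v :
  is_derive x v f df -> is_derive x v g dg ->
  is_derive x v (fun y => dot (f y) (g y)) (dot df (g x) + dot (f x) dg).
Proof.
move=> /is_derive_mxP fdf /is_derive_mxP gdg.
apply: is_derive_eq.
  by apply: is_derive_bigsum => k _;
    exact: (is_deriveM (f := fun y => f y 0 k) (g := fun y => g y 0 k)).
rewrite -big_split; apply: eq_bigr => k _ /=.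
by rewrite addrC; congr (_ + _); rewrite mulrC.
Qed.

Lemma is_derive_scalemx m n (c : V -> R) (M : V -> 'M[R]_(m, n)) dc dM x v :
  is_derive x v c dc -> is_derive x v M dM ->
  is_derive x v (fun y => c y *: M y) (dc *: M x + c x *: dM).
Proof.
move=> cdc /is_derive_mxP MdM; apply/is_derive_mxP => i j.
rewrite (_ : (fun y => _) = c * (fun y => M y i j)); last by apply/funext => y; rewrite mxE.
by apply: is_derive_eq; rewrite !mxE addrC; congr (_ + _); rewrite mulrC.
Qed.

Lemma is_derive_det n (M : V -> 'M[R]_n) dM x v : is_derive x v M dM ->
  is_derive x v (fun y => \det (M y)) (\tr (\adj (M x) *m dM)).
Proof.
move=> /is_derive_mxP MdM; rewrite mxtrace_adj_mul.
apply: is_derive_bigsum => s _; apply: (is_deriveZ (f := fun y => \prod_i M y i (s i))).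
exact: (is_derive_bigprod (F := fun i y => M y i (s i)) (index_enum_uniq _)).
Qed.

Lemma derive_invmx n (M : V -> 'M[R]_n) x v : (\forall y \near x, M y \in unitmx) ->
  derivable M x v -> derivable (fun y => invmx (M y)) x v ->
  'D_v (fun y => invmx (M y)) x = - (invmx (M x) *m 'D_v M x *m invmx (M x)).
Proof.
move=> uM dM dI; have uMx := nbhs_singleton uM.
have [_] := is_derive_mulmx (derivableP dM) (derivableP dI).
rewrite (near_eq_derive (g := cst 1%:M)); last first.
  by apply: filterS uM => y uMy; rewrite mulmxV.
rewrite derive_cst => /esym/eqP; rewrite addrC addr_eq0 => /eqP.
by move=> /(congr1 (mulmx (invmx (M x)))); rewrite mulKmx // mulmxN mulmxA.
Qed.

Lemma is_derive_ln (f : V -> R) x v df : 0 < f x -> is_derive x v f df ->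
  is_derive x v (fun y => ln (f y)) ((f x)^-1 * df).
Proof. by move=> f0; apply: is_derive_comp1; exact: is_derive1_ln. Qed.

Lemma near_eq_differentiable (W : normedModType R) (f g : V -> W) x :
  (\forall y \near x, f y = g y) -> differentiable f x -> differentiable g x.
Proof.
move=> fg df; have [cdf /eqaddoP fE] := (diff_locallyP _ _).1 df.
have fg0 : \forall h \near (0 : V), f (h + x) = g (h + x).
  by have := fg; rewrite (near_shift 0) /= subr0.
have gE : g \o shift x = cst (g x) + 'd f x +o_ (0 : V) id.
  apply/eqaddoP => e e0; near=> h.
  rewrite -![(_ + _ : _ -> _) _]/(_ + _) -![(- _ : _ -> _) _]/(- _) /=.
  by rewrite -(nbhs_singleton fg) -(near fg0 h) //; near: h; exact: fE.
by apply/diff_locallyP; rewrite (diff_unique cdf gE).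
Unshelve. all: by end_near. Qed.

Lemma differentiable_mxP m n (M : V -> 'M[R]_(m, n)) x :
  differentiable M x <-> forall i j, differentiable (fun y => M y i j) x.
Proof.
split=> [dM i j|dM].
  apply: (differentiable_comp dM (g := fun A : 'M[R]_(m, n) => A i j)).
  exact: differentiable_coord.
rewrite (_ : M = \sum_i \sum_j (fun y => M y i j *: delta_mx i j)).
  by apply: differentiable_sum => i; apply: differentiable_sum => j; exact: differentiableZl.
apply/funext => y; rewrite fct_sumE [LHS]matrix_sum_delta; apply: eq_bigr => i _.
by rewrite fct_sumE.
Qed.

Lemma linear_rV_continuous n (L : {linear 'rV[R]_n -> V}) : continuous L.
Proof.
rewrite (_ : (L : 'rV[R]_n -> V) = fun v : 'rV[R]_n => \sum_i v 0 i *: L (delta_mx 0 i)).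
  apply: continuous_big => [|i _ v]; first exact: add_continuous.
  by apply: (@cvgZr_tmp _ _ _ (nbhs v)); exact: coord_continuous.
apply/funext => v; rewrite {1}(row_sum_delta v) linear_sum.
by apply: eq_bigr => i _; rewrite linearZ.
Qed.

End DerivativeRules.

(** * Euclidean linear algebra *)

Lemma ler_mx_norm_coord (R : realDomainType) (m n : nat) (A : 'M[R]_(m, n)) i j :
  `|A i j| <= `|A|.
Proof.
rewrite [leRHS]/Num.Def.normr /= mx_normrE.
exact: (le_bigmax _ (fun ij => `|A ij.1 ij.2|) (i, j)).
Qed.

Section EuclideanInnerProduct.
Variables (R : realType) (n : nat).
Implicit Types (i : 'I_n) (x y v w : 'rV[R]_n) (H : 'M[R]_n).

Lemma dotE v w : dot v w = (v *m w^T) 0 0.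
Proof. by rewrite [RHS]mxE; apply: eq_bigr => i _; rewrite !mxE. Qed.

Lemma dotC v w : dot v w = dot w v.
Proof. by apply: eq_bigr => i _; rewrite mulrC. Qed.

Lemma dotDl x y v : dot (x + y) v = dot x v + dot y v.
Proof. by rewrite !dotE mulmxDl mxE. Qed.

Lemma dotZl a x v : dot (a *: x) v = a * dot x v.
Proof. by rewrite !dotE -scalemxAl mxE. Qed.

Lemma dotNl x v : dot (- x) v = - dot x v.
Proof. by rewrite !dotE mulNmx mxE. Qed.

Lemma dotDr x y v : dot v (x + y) = dot v x + dot v y.
Proof. by rewrite !(dotC v) dotDl. Qed.

Lemma dotZr a x v : dot v (a *: x) = a * dot v x.
Proof. by rewrite !(dotC v) dotZl. Qed.

Lemma dotNr x v : dot v (- x) = - dot v x.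
Proof. by rewrite !(dotC v) dotNl. Qed.

Lemma dot0l v : dot 0 v = 0.
Proof. by rewrite dotE mul0mx mxE. Qed.

Lemma dot_delta i v : dot (delta_mx 0 i) v = v 0 i.
Proof. by rewrite dotE -rowE !mxE. Qed.

Lemma dot_mulmx_tr v w H : dot (v *m H) w = dot v (w *m H^T).
Proof. by rewrite !dotE trmx_mul trmxK mulmxA. Qed.

Lemma dot_ge0 v : 0 <= dot v v.
Proof. by apply: sumr_ge0 => i _; rewrite -expr2 sqr_ge0. Qed.

Lemma dot_eq0 v : (dot v v == 0) = (v == 0).
Proof.
apply/eqP/eqP => [/eqP|->]; last exact: dot0l.
rewrite psumr_eq0 => [/allP v0|i _]; last by rewrite -expr2 sqr_ge0.
apply/rowP => i; rewrite mxE; have := v0 i (mem_index_enum _).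
by rewrite mulf_eq0 orbb => /eqP.
Qed.

Lemma dot_gt0 v : v != 0 -> 0 < dot v v.
Proof. by move=> v0; rewrite lt0r dot_eq0 v0 dot_ge0. Qed.

Lemma enorm_gt0 v : v != 0 -> 0 < enorm v.
Proof. by move=> v0; rewrite sqrtr_gt0 dot_gt0. Qed.

Lemma dot_normalize v : v != 0 -> dot ((enorm v)^-1 *: v) ((enorm v)^-1 *: v) = 1.
Proof.
move=> v0; rewrite dotZl dotZr mulrA -invfM -expr2 sqr_sqrtr ?dot_ge0 //.
by rewrite mulVf // dot_eq0.
Qed.

Lemma enorm_le_norm v : enorm v <= Num.sqrt n%:R * `|v|.
Proof.
have -> : Num.sqrt n%:R * `|v| = Num.sqrt (n%:R * `|v| ^+ 2).
  by rewrite sqrtrM ?ler0n // sqrtr_sqr normr_id.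
rewrite ler_wsqrtr //; set e := `|v| ^+ 2.
have -> : n%:R * e = \sum_(i < n) e by rewrite sumr_const card_ord mulr_natl.
apply: ler_sum => i _; rewrite /e.
rewrite -expr2 -(real_normK (num_real (v 0 i))).
by rewrite lerXn2r ?nnegrE // ler_mx_norm_coord.
Qed.

Lemma continuous_dot (T : topologicalType) (f g : T -> 'rV[R]_n) (t : T) :
  {for t, continuous f} -> {for t, continuous g} ->
  {for t, continuous (fun s => dot (f s) (g s))}.
Proof.
move=> cf cg; apply: cvg_big => [|i _]; first exact: add_continuous.
have ccoord (h : T -> 'rV[R]_n) : {for t, continuous h} ->
    {for t, continuous (fun s => h s 0 i)}.
  move=> ch; apply: (continuous_comp (g := fun z : 'rV[R]_n => z 0 i) ch).
  exact: coord_continuous.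
by apply: cvgM; exact: ccoord.
Qed.

Lemma dot_continuous v : continuous (fun y => dot y v).
Proof. by move=> y; apply: continuous_dot; [exact: cvg_id | exact: cst_continuous]. Qed.

End EuclideanInnerProduct.

Definition posdef (R : numDomainType) (n : nat) (A : 'M[R]_n) :=
  forall v : 'rV[R]_n, v != 0 -> 0 < (v *m A *m v^T) 0 0.

Section PositiveDefinite.
Variables (R : rcfType) (n : nat).
Implicit Types (A : 'M[R]_n).

Lemma posdefZ a A : 0 < a -> posdef A -> posdef (a *: A).
Proof. by move=> a0 pA v v0; rewrite -scalemxAr -scalemxAl mxE mulr_gt0 // pA. Qed.

Lemma posdef_eigenvalue_gt0 A a : posdef A -> eigenvalue A a -> 0 < a.
Proof.
move=> pA /eigenvalueP[v vA v0]; have := pA v v0; rewrite vA -scalemxAl mxE.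
have vv_ge0 : 0 <= (v *m v^T) 0 0 by rewrite mxE sumr_ge0 // => i _; rewrite mxE -expr2 sqr_ge0.
by apply: contraTT; rewrite -!leNgt => a0; exact: mulr_le0_ge0.
Qed.

(* The monic polynomial [char_poly (- A)] has no root on [[0, +oo)], and its value at [0] is
   [\det A]. *)
Lemma posdef_det_gt0 A : posdef A -> 0 < \det A.
Proof.
move=> pA; pose p := char_poly (- A).
have p0 : p.[0] = \det A.
  rewrite horner_coef0 char_poly_det -(scaleN1r A) detZ mulrA -exprMn.
  by rewrite mulrN1 opprK expr1n mul1r.
have p_neq0 t : 0 <= t -> ~~ root p t.
  rewrite -eigenvalue_root_char leNgt; apply: contra => /eigenvalueP[v vA v0].
  rewrite -oppr_gt0; apply: (posdef_eigenvalue_gt0 pA); apply/eigenvalueP.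
  by exists v => //; rewrite -[A]opprK mulmxN vA scaleNr.
have lc1 : lead_coef p = 1 by exact/monicP/char_poly_monic.
have [|M pM] := @poly_pinfty_gt_lc _ p; first by rewrite lc1.
rewrite -p0 ltNge; apply/negP => p0_le0.
have M0 : 0 <= Num.max 0 M by rewrite le_max lexx.
have [|t /andP[t0 _] pt] := @poly_ivt _ p _ _ M0; last by have := p_neq0 t t0; rewrite pt.
by rewrite p0_le0 (le_trans _ (pM _ _)) ?le_max ?lexx ?orbT // lc1.
Qed.

Lemma posdef_unitmx A : posdef A -> A \in unitmx.
Proof. by move=> /posdef_det_gt0 dA; rewrite unitmxE unitfE gt_eqF. Qed.

Lemma posdef_invmx A : A^T = A -> posdef A -> posdef (invmx A).
Proof.
move=> AT pA v v0; have uA := posdef_unitmx pA.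
have vE : v = v *m invmx A *m A by rewrite mulmxKV.
rewrite [v^T](congr1 trmx vE) trmx_mul AT -mulmxA mulmxA.
by rewrite mulmxA; apply: pA; apply: contraNneq v0 => w0; rewrite vE w0 mul0mx.
Qed.

End PositiveDefinite.

Lemma quadratic_ge0_linear_eq0 (R : realFieldType) (a b : R) :
  (forall t, 0 <= t * b + t * t * a) -> b = 0.
Proof.
move=> q0; apply/eqP/negPn/negP => b0; pose c := `|a| + 1.
have c0 : 0 < c by rewrite ltr_wpDl.
have ac : a < c by rewrite /c ltr_pwDr // ler_norm.
have := q0 (- b / c); rewrite leNgt => /negP; apply.
rewrite (_ : _ + _ = - (b ^+ 2 * (c - a)) / c ^+ 2); last by field; rewrite gt_eqF.
rewrite mulNr oppr_lt0 divr_gt0 ?exprn_gt0 // mulr_gt0 ?subr_gt0 //.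
by rewrite exprn_even_gt0.
Qed.

Section Rayleigh.
Variables (R : realType) (n : nat).
Implicit Types (v w N : 'rV[R]_n) (H : 'M[R]_n).

Definition unit_tangent N := [set v | dot v v = 1 /\ dot v N = 0].

Lemma compact_unit_tangent N : compact (unit_tangent N).
Proof.
apply: bounded_closed_compact.
  exists 1; split; first exact: num_real.
  move=> M M1 v [v1 _]; apply: le_trans (ltW M1).
  rewrite /Num.Def.normr /= mx_normrE; apply: bigmax_le => //= -[k i] _ /=.
  rewrite (ord1 k) -(ler_pXn2r (n := 2)) ?nnegrE // expr1n -normrX ger0_norm ?sqr_ge0 //.
  rewrite -v1 /dot (bigD1 i) //= -expr2 lerDl; apply: sumr_ge0 => j _.
  by rewrite -expr2 sqr_ge0.
rewrite (_ : unit_tangent N =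
  (fun v => dot v v) @^-1` [set 1] `&` (fun v => dot v N) @^-1` [set 0]) //.
apply: closedI; apply: closed_comp; try exact: closed_eq.
- by move=> v _; apply: continuous_dot; exact: cvg_id.
- by move=> v _; exact: dot_continuous.
Qed.

Lemma rayleigh_tangent_min H N v0 : v0 != 0 -> dot v0 N = 0 ->
  exists v, [/\ dot v v = 1, dot v N = 0 &
    forall w, dot w N = 0 -> dot (v *m H) v * dot w w <= dot (w *m H) w].
Proof.
move=> v00 v0N; pose q w := dot (w *m H) w.
have cq : continuous q.
  move=> w; apply: (continuous_dot (f := mulmxr H)); last exact: cvg_id.
  exact: linear_rV_continuous.
have normalize w : w != 0 -> dot w N = 0 ->
    (enorm w)^-1 *: w \in unit_tangent N.
  by move=> w0 wN; rewrite inE; split; [exact: dot_normalize | rewrite dotZl wN mulr0].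
have [||v vS vmin] := @EVT_min_rV R n q _ _ (@compact_unit_tangent N).
- by exists ((enorm v0)^-1 *: v0); apply: set_mem; exact: normalize.
- exact: continuous_subspaceT.
have [v1 vN] := set_mem vS; exists v; split => // w wN.
have [->|w0] := eqVneq w 0; first by rewrite mul0mx !dot0l mulr0.
have := vmin _ (normalize w w0 wN).
rewrite /q -scalemxAl dotZl dotZr mulrA -expr2 exprVn sqr_sqrtr ?dot_ge0 //.
by rewrite ler_pdivlMl ?dot_gt0 // mulrC.
Qed.

(* Lagrange multipliers: [v H - m v] is orthogonal to every vector orthogonal to [N]. *)
Lemma rayleigh_tangent_eigen H N v : H^T = H -> N != 0 -> dot v v = 1 -> dot v N = 0 ->
  (forall w, dot w N = 0 -> dot (v *m H) v * dot w w <= dot (w *m H) w) ->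
  exists a, v *m H = dot (v *m H) v *: v + a *: N.
Proof.
move=> HT N0 v1 vN; set m := dot (v *m H) v => vmin; pose z := v *m H - m *: v.
have zT w : dot w N = 0 -> dot z w = 0.
  move=> wN; suff : 2 * dot z w = 0 by move/eqP; rewrite mulf_eq0 pnatr_eq0 /= => /eqP.
  apply: (@quadratic_ge0_linear_eq0 _ (dot (w *m H) w - m * dot w w)) => t.
  have := vmin (v + t *: w); rewrite dotDl dotZl vN wN mulr0 addr0 => /(_ erefl).
  have wHv : dot (w *m H) v = dot (v *m H) w by rewrite dot_mulmx_tr HT dotC.
  rewrite -subr_ge0 /z !mulmxDl -!scalemxAl !(dotDl, dotDr, dotZl, dotZr, dotNl).
  by rewrite wHv -/m v1 (dotC w v); lra.
pose a := dot z N / dot N N; exists a.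
have zaN : dot (z - a *: N) N = 0.
  by rewrite dotDl dotNl dotZl /a divfK ?subrr // gt_eqF // dot_gt0.
suff zE : z = a *: N by rewrite -zE /z addrC subrK.
apply/eqP; rewrite -subr_eq0 -dot_eq0 {1}dotDl dotNl dotZl zT //.
by rewrite (dotC N) zaN mulr0 subr0.
Qed.

End Rayleigh.

(** * Smooth functions *)

Lemma open_near (T : topologicalType) (U : set T) (x : T) (P : set T) : open U -> U x ->
  (forall y, U y -> P y) -> \forall y \near x, P y.
Proof. by move=> oU Ux UP; apply: filterS UP _; exact: open_nbhs_nbhs. Qed.

Section Smooth.
Variables (R : realType) (n : nat).
Implicit Types (i j k : 'I_n) (x y v : 'rV[R]_n) (f g : 'rV[R]_n -> R) (U : set 'rV[R]_n).

Lemma smooth_onS U f : smooth_on U f <->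
  (forall x, U x -> differentiable f x) /\ forall i, smooth_on U (partial i f).
Proof.
split=> [sf|[df sf] s].
  split=> [|i s x Ux]; first exact: (sf [::]).
  by have := sf (rcons s i) x Ux; rewrite /partials foldr_rcons.
by case/lastP: s => [//|s i]; rewrite /partials foldr_rcons; exact: sf.
Qed.

Lemma smooth_differentiable U f x : smooth_on U f -> U x -> differentiable f x.
Proof. by move=> /smooth_onS[+ _]; exact. Qed.

Lemma smooth_derivable U f x v : smooth_on U f -> U x -> derivable f x v.
Proof. by move=> sf Ux; exact/diff_derivable/(smooth_differentiable sf). Qed.

Lemma smooth_partial U f i : smooth_on U f -> smooth_on U (partial i f).
Proof. by move=> /smooth_onS[]. Qed.

Lemma smooth_on_coind U (P : ('rV[R]_n -> R) -> Prop) : open U ->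
  (forall f, P f -> (forall x, U x -> differentiable f x) /\
    forall i, exists2 g, P g & forall x, U x -> partial i f x = g x) ->
  forall f, P f -> smooth_on U f.
Proof.
move=> oU Pstep f Pf s x Ux.
have [g Pg fg] : exists2 g, P g & forall y, U y -> partials s f y = g y.
  elim: s => [|i s [g Pg fg]]; first by exists f.
  have [_ /(_ i)[h Ph gh]] := Pstep g Pg; exists h => // y Uy; rewrite -gh //.
  by apply: near_eq_derive; exact: open_near fg.
apply: near_eq_differentiable ((Pstep g Pg).1 x Ux).
by apply: (open_near oU Ux) => y /fg.
Qed.

Lemma smooth_ext U f g : open U -> (forall y, U y -> f y = g y) ->
  smooth_on U f -> smooth_on U g.
Proof.
move=> oU fg sf; apply: (smooth_on_coind (P := fun g => exists2 f, smooth_on U f &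
  forall y, U y -> f y = g y)) => //; last by exists f.
move=> {f g fg sf} g [f sf fg]; split=> [x Ux|i].
  apply: near_eq_differentiable (smooth_differentiable sf Ux); exact: open_near fg.
exists (partial i f); first by exists (partial i f) => //; exact: smooth_partial.
by move=> x Ux; apply: near_eq_derive; apply: (open_near oU Ux) => y /fg.
Qed.

Lemma smooth_cst U (c : R) : open U -> smooth_on U (fun=> c).
Proof.
move=> oU; apply: (smooth_on_coind (P := fun f => exists c, f = fun=> c)) => //.
  move=> _ [a ->]; split=> [x _|i]; first exact: differentiable_cst.
  by exists (fun=> 0) => [|x _]; [exists 0 | exact: derive_cst].
by exists c.
Qed.

(* This class is visibly closed under partial derivatives, hence smooth by coinduction. *)
Inductive smooth_closure U : ('rV[R]_n -> R) -> Prop :=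
| SmoothBase f of smooth_on U f : smooth_closure U f
| SmoothAdd f g of smooth_closure U f & smooth_closure U g :
    smooth_closure U (fun y => f y + g y)
| SmoothMul f g of smooth_closure U f & smooth_closure U g :
    smooth_closure U (fun y => f y * g y)
| SmoothInv f of (forall x, U x -> f x != 0) & smooth_closure U f :
    smooth_closure U (fun y => (f y)^-1).

Lemma smooth_closure_smooth U f : open U -> smooth_closure U f -> smooth_on U f.
Proof.
move=> oU; apply: smooth_on_coind => {f} // f.
elim=> [{}f /smooth_onS[df sf]|{}f g Cf [df pf] Cg [dg pg]|{}f g Cf [df pf] Cg [dg pg]
  |{}f f0 Cf [df pf]].
- by split=> // i; exists (partial i f) => //; exact: SmoothBase.
- split=> [x Ux|i]; first by apply: differentiableD; [exact: df | exact: dg].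
  have [f' Cf' fE] := pf i; have [g' Cg' gE] := pg i.
  exists (fun y => f' y + g' y) => [|x Ux]; first exact: SmoothAdd.
  rewrite -fE // -gE //; apply: deriveD; apply: diff_derivable; [exact: df | exact: dg].
- split=> [x Ux|i]; first by apply: differentiableM; [exact: df | exact: dg].
  have [f' Cf' fE] := pf i; have [g' Cg' gE] := pg i.
  exists (fun y => f y * g' y + g y * f' y) => [|x Ux].
    by apply: SmoothAdd; exact: SmoothMul.
  rewrite -fE // -gE //; apply: deriveM; apply: diff_derivable; [exact: df | exact: dg].
- split=> [x Ux|i]; first by apply: differentiableV; [exact: df | exact: f0].
  have [f' Cf' fE] := pf i.
  exists (fun y => -1 * ((f y)^-1 * (f y)^-1) * f' y) => [|x Ux].
    apply: SmoothMul Cf'; apply: SmoothMul; first exact/SmoothBase/smooth_cst.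
    by apply: SmoothMul; exact: SmoothInv.
  rewrite -fE // mulN1r -invfM -expr2; apply: deriveV; first exact: f0.
  by apply: diff_derivable; exact: df.
Qed.

Lemma smoothD U f g : open U -> smooth_on U f -> smooth_on U g ->
  smooth_on U (fun y => f y + g y).
Proof. by move=> oU sf sg; apply/smooth_closure_smooth/SmoothAdd; [|exact: SmoothBase..]. Qed.

Lemma smoothM U f g : open U -> smooth_on U f -> smooth_on U g ->
  smooth_on U (fun y => f y * g y).
Proof. by move=> oU sf sg; apply/smooth_closure_smooth/SmoothMul; [|exact: SmoothBase..]. Qed.

Lemma smoothV U f : open U -> (forall x, U x -> f x != 0) -> smooth_on U f ->
  smooth_on U (fun y => (f y)^-1).
Proof. by move=> oU f0 sf; apply/smooth_closure_smooth/SmoothInv; [| |exact: SmoothBase]. Qed.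

Lemma smoothB U f g : open U -> smooth_on U f -> smooth_on U g ->
  smooth_on U (fun y => f y - g y).
Proof.
move=> oU sf sg; rewrite (_ : (fun _ => _) = fun y => f y + -1 * g y).
  by apply: smoothD => //; apply: smoothM => //; exact: smooth_cst.
by apply/funext => y; rewrite mulN1r.
Qed.

Lemma smooth_bigsum U (I : Type) (r : seq I) (P : pred I) (F : I -> 'rV[R]_n -> R) :
  open U -> (forall i : I, P i -> smooth_on U (F i)) ->
  smooth_on U (fun y => \sum_(i <- r | P i) F i y).
Proof.
move=> oU sF; rewrite -fct_sumE; elim/big_ind: _ => //; first exact: smooth_cst.
by move=> f g; exact: smoothD.
Qed.

Lemma smooth_bigprod U (I : Type) (r : seq I) (P : pred I) (F : I -> 'rV[R]_n -> R) :
  open U -> (forall i : I, P i -> smooth_on U (F i)) ->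
  smooth_on U (fun y => \prod_(i <- r | P i) F i y).
Proof.
move=> oU sF; rewrite -fct_prodE; elim/big_ind: _ => //; first exact: smooth_cst.
by move=> f g; exact: smoothM.
Qed.

Lemma smooth_ln U f : open U -> (forall x, U x -> 0 < f x) -> smooth_on U f ->
  smooth_on U (fun y => ln (f y)).
Proof.
move=> oU f0 sf; have df x Ux := smooth_differentiable (x := x) sf Ux.
apply/smooth_onS; split=> [x Ux|i].
  apply: (differentiable_comp (df x Ux) (g := @ln R)); apply/derivable1_diffP.
  by have [] := is_derive1_ln (f0 x Ux).
apply: (smooth_ext (f := fun y => (f y)^-1 * partial i f y)) => // [y Uy|].
  by apply/esym/derive_val/is_derive_ln; [exact: f0 | exact/derivableP/diff_derivable/df].
apply: smoothM => //; last exact: smooth_partial.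
by apply: smoothV => // x Ux; rewrite gt_eqF // f0.
Qed.

Lemma partialC U f x i j : open U -> smooth_on U f -> U x ->
  partial i (partial j f) x = partial j (partial i f) x.
Proof.
move=> oU sf Ux.
have nd k l : \forall y \near x, derivable f y (delta_mx 0 k) /\
    derivable (partial k f) y (delta_mx 0 l).
  apply: (open_near oU Ux) => y Uy; split; apply: smooth_derivable Uy => //.
  exact: smooth_partial.
have cd k l : {for x, continuous (partial l (partial k f))}.
  apply: differentiable_continuous.
  exact: smooth_differentiable (smooth_partial l (smooth_partial k sf)) Ux.
exact: (deriveC (nd j i) (nd i j) (cd j i) (cd i j)).
Qed.

End Smooth.

Definition smooth_mx_on (R : realType) (n p q : nat) (U : set 'rV[R]_n)
    (M : 'rV[R]_n -> 'M[R]_(p, q)) :=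
  forall i j, smooth_on U (fun y => M y i j).

Section SmoothMatrix.
Variables (R : realType) (n : nat) (U : set 'rV[R]_n).
Hypothesis oU : open U.

Lemma smooth_mx_differentiable p q (M : 'rV[R]_n -> 'M[R]_(p, q)) x :
  smooth_mx_on U M -> U x -> differentiable M x.
Proof. by move=> sM Ux; apply/differentiable_mxP => i j; exact: smooth_differentiable Ux. Qed.

Lemma smooth_mx_derivable p q (M : 'rV[R]_n -> 'M[R]_(p, q)) x v :
  smooth_mx_on U M -> U x -> derivable M x v.
Proof. by move=> sM Ux; exact/diff_derivable/(smooth_mx_differentiable sM). Qed.

Lemma smooth_mx_id : smooth_mx_on U (fun x : 'rV[R]_n => x).
Proof.
move=> i j; apply/smooth_onS; split=> [x _|k]; first exact: differentiable_coord.
rewrite (_ : partial k _ = fun=> (delta_mx 0 k : 'rV[R]_n) i j); first exact: smooth_cst.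
apply/funext => x; apply: derive_val.
exact: (proj1 (is_derive_mxP _ _ _ _) (is_derive_id x _)).
Qed.

Lemma smooth_dot (f g : 'rV[R]_n -> 'rV[R]_n) : smooth_mx_on U f -> smooth_mx_on U g ->
  smooth_on U (fun y => dot (f y) (g y)).
Proof. by move=> sf sg; apply: smooth_bigsum => // i _; exact: smoothM. Qed.

Lemma smooth_det m (M : 'rV[R]_n -> 'M[R]_m) : smooth_mx_on U M ->
  smooth_on U (fun y => \det (M y)).
Proof.
move=> sM; apply: smooth_bigsum => // s _; apply: smoothM => //; first exact: smooth_cst.
by apply: smooth_bigprod => // i _; exact: sM.
Qed.

Lemma smooth_invmx m (M : 'rV[R]_n -> 'M[R]_m) : smooth_mx_on U M ->
  (forall x, U x -> M x \in unitmx) -> smooth_mx_on U (fun y => invmx (M y)).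
Proof.
move=> sM uM i j.
apply: (smooth_ext (f := fun y => (\det (M y))^-1 *
  ((-1) ^+ (j + i) * \det (row' j (col' i (M y)))))) => // [y Uy|].
  by rewrite /invmx uM // !mxE.
apply: smoothM => //.
  by apply: smoothV => // [x /uM|]; [rewrite unitmxE unitfE | exact: smooth_det].
apply: smoothM => //; first exact: smooth_cst.
apply: smooth_det => a b; rewrite (_ : (fun _ => _) = fun y => M y (lift j a) (lift i b)) //.
by apply/funext => y; rewrite !mxE.
Qed.

End SmoothMatrix.

Section GradientHessian.
Variables (R : realType) (n : nat).
Implicit Types (i j k : 'I_n) (x y v : 'rV[R]_n) (f g : 'rV[R]_n -> R) (U : set 'rV[R]_n).

Lemma deriveEgrad f x v : differentiable f x -> 'D_v f x = dot v (grad f x).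
Proof.
move=> df; rewrite deriveE // {1}(row_sum_delta v) linear_sum.
by apply: eq_bigr => i _; rewrite linearZ /= mxE /partial deriveE.
Qed.

Lemma grad_coord f i : (fun y => grad f y 0 i) = partial i f.
Proof. by apply/funext => y; rewrite mxE. Qed.

Lemma hess_coord f i j : (fun y => hess f y i j) = partial i (partial j f).
Proof. by apply/funext => y; rewrite mxE. Qed.

Lemma smooth_grad U f : smooth_on U f -> smooth_mx_on U (grad f).
Proof. by move=> sf i j; rewrite (ord1 i) grad_coord; exact: smooth_partial. Qed.

Lemma smooth_hess U f : smooth_on U f -> smooth_mx_on U (hess f).
Proof. by move=> sf i j; rewrite hess_coord; do 2!apply: smooth_partial. Qed.

Lemma hess_sym U f x : open U -> smooth_on U f -> U x -> (hess f x)^T = hess f x.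
Proof. by move=> oU sf Ux; apply/matrixP => i j; rewrite !mxE; exact: partialC oU _ _. Qed.

Lemma is_derive_grad U f x v : smooth_on U f -> U x ->
  is_derive x v (grad f) (v *m hess f x).
Proof.
move=> sf Ux; apply/is_derive_mxP => k i; rewrite (ord1 k) grad_coord.
split; first exact: smooth_derivable (smooth_partial i sf) Ux.
rewrite deriveEgrad; last exact: smooth_differentiable (smooth_partial i sf) Ux.
by rewrite mxE; apply: eq_bigr => j _; rewrite !mxE.
Qed.

Lemma is_derive_dot_grad U f x v w : smooth_on U f -> U x ->
  is_derive x v (fun y => dot w (grad f y)) (dot w (v *m hess f x)).
Proof.
move=> sf Ux; apply: is_derive_eq.
  by apply: is_derive_dot; exact: is_derive_grad Ux.
by rewrite dot0l add0r.
Qed.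

End GradientHessian.

(** * Strictly convex boundaries *)

Section UnitNormal.
Variables (R : realType) (n : nat) (V : set 'rV[R]_n) (rho : 'rV[R]_n -> R).
Hypotheses (oV : open V) (srho : smooth_on V rho).
Hypothesis (grad_neq0 : forall x, V x -> grad rho x != 0).
Implicit Types (p v : 'rV[R]_n).

Lemma derivable_enorm_grad p v : V p -> derivable (fun y => enorm (grad rho y)) p v.
Proof.
move=> Vp; have dgrad := is_derive_grad v srho Vp.
pose sq_norm y := dot (grad rho y) (grad rho y).
have sqrt_dot := is_derive1_sqrt (dot_gt0 (grad_neq0 Vp)).
by have [] := is_derive_comp1 (f := sq_norm) sqrt_dot (is_derive_dot dgrad dgrad).
Qed.

Lemma is_derive_unit_normal p v : V p -> is_derive p v (unit_normal rho)
  ('D_v (fun y => (enorm (grad rho y))^-1) p *: grad rho p +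
   (enorm (grad rho p))^-1 *: (v *m hess rho p)).
Proof.
move=> Vp; apply: is_derive_scalemx; last exact: is_derive_grad Vp.
apply/derivableP/derivableV; last exact: derivable_enorm_grad.
by rewrite gt_eqF // enorm_gt0 // grad_neq0.
Qed.

Lemma derive_unit_normal_orthogonal p v : V p ->
  dot ('D_v (unit_normal rho) p) (unit_normal rho p) = 0.
Proof.
move=> Vp; have [dnu _] := is_derive_unit_normal v Vp.
have nu_unit : \forall y \near p,
    dot (unit_normal rho y) (unit_normal rho y) = (cst 1 : 'rV[R]_n -> R) y.
  by apply: (open_near oV Vp) => y Vy; exact/dot_normalize/grad_neq0.
have [_] := is_derive_dot (derivableP dnu) (derivableP dnu).
rewrite (near_eq_derive _ nu_unit) derive_cst [X in _ + X]dotC -mulr2n => /esym/eqP.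
by rewrite mulrn_eq0 => /eqP.
Qed.

End UnitNormal.

Section StrictlyConvexBoundary.
Variables (R : realType) (n : nat).
Implicit Types (x y v p : 'rV[R]_n) (rho : 'rV[R]_n -> R) (V Omega : set 'rV[R]_n).

(* A minimizer of the Rayleigh quotient of the Hessian on the tangent space is a principal
   direction, and the minimum is a positive multiple of its principal curvature. *)
Lemma tangent_hess_gt0 Omega p V rho v :
  (forall kappa, principal_curvature Omega p kappa -> 0 < kappa) ->
  local_defining_function Omega p V rho ->
  v != 0 -> dot v (grad rho p) = 0 -> 0 < dot (v *m hess rho p) v.
Proof.
move=> curv ldf v0 vN; have [oV Vp srho g0 _] := ldf.
set N := grad rho p in vN *; set H := hess rho p; set c := enorm N.
have N0 : N != 0 by exact: g0.
have c0 : 0 < c by exact: enorm_gt0.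
have [w [w1 wN wmin]] := rayleigh_tangent_min H v0 vN.
have [a wH] := rayleigh_tangent_eigen (hess_sym oV srho Vp) N0 w1 wN wmin.
set m := dot (w *m H) w in wmin wH.
have w0 : w != 0 by rewrite -dot_eq0 w1 oner_eq0.
apply: lt_le_trans (wmin v vN); rewrite mulr_gt0 ?dot_gt0 //.
suff : 0 < c^-1 * m by rewrite pmulr_rgt0 ?invr_gt0.
apply: curv; exists V, rho, w; split => //; first by rewrite dotZr wN mulr0.
have [_ Dnu] := is_derive_unit_normal srho g0 w Vp.
set b := 'D_w (fun y => (enorm _)^-1) p in Dnu; have {}Dnu : 'D_w (unit_normal rho) p =
    (c^-1 * m) *: w + (b + c^-1 * a) *: N.
  by rewrite Dnu -/N -/c -/H wH scalerDr !scalerA [in RHS]scalerDl addrCA addrA.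
have := derive_unit_normal_orthogonal oV srho g0 w Vp.
rewrite Dnu dotZr dotDl !dotZl wN mulr0 add0r => /eqP.
rewrite !mulf_eq0 invr_eq0 (gt_eqF c0) dot_eq0 (negbTE N0) orbF /= => /eqP ->.
by rewrite scale0r addr0.
Qed.

Lemma defining_function_le0 Omega p V rho x : local_defining_function Omega p V rho ->
  V x -> closure Omega x -> rho x <= 0.
Proof.
move=> [oV _ srho _ OV] Vx cOx; rewrite leNgt; apply/negP => rho_x.
have crho : rho @ x --> rho x.
  exact: differentiable_continuous (smooth_differentiable srho Vx).
have [y [Oy [Vy]]] : Omega `&` (V `&` [set y | 0 < rho y]) !=set0.
  by apply: cOx; apply: filterI; [exact: open_nbhs_nbhs | exact: (cvgr_gt _ crho)].
have : (Omega `&` V) y by [].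
by rewrite OV /= => -[rho_y _] /lt_trans/(_ rho_y); rewrite ltxx.
Qed.

Lemma defining_function_eq0 Omega p V rho : open Omega -> boundary Omega p ->
  local_defining_function Omega p V rho -> rho p = 0.
Proof.
move=> oO [cOp nOp] ldf; have [_ Vp _ _ OV] := ldf.
apply/eqP; rewrite eq_le (defining_function_le0 ldf) //= leNgt; apply/negP => rho_p.
apply: nOp; have : ([set x | rho x < 0] `&` V) p by [].
by rewrite -OV => -[Op _]; move: oO; rewrite openE; apply.
Qed.

(* If a segment in the closure touched the boundary, the defining function would have a maximum
   along it there, against positive curvature. *)
Lemma segment_interior Omega x y (t : R) : open Omega ->
  smooth_strictly_convex_boundary Omega -> x != y -> 0 < t < 1 ->
  (forall s : R, 0 <= s <= 1 -> closure Omega (x + s *: (y - x))) ->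
  Omega (x + t *: (y - x)).
Proof.
move=> oO [sb curv] xy /andP[t0 t1] cO.
set v := y - x in cO *; set p := x + t *: v.
have [//|nOp] := pselect (Omega p); exfalso.
have bp : boundary Omega p.
  by split; [apply: cO; rewrite !ltW | move=> /interior_subset].
have [V [rho ldf]] := sb _ bp; have [oV Vp srho g0 _] := ldf.
have v0 : v != 0 by rewrite subr_eq0 eq_sym.
have near_cO : \forall s \near (0 : R), closure Omega (p + s *: v).
  near=> s; rewrite /p -addrA -scalerDl; apply: cO.
  have : `|s| < Num.min t (1 - t).
    by near: s; apply: (@nbhs0_lt R R); rewrite lt_min t0 subr_gt0 t1.
  by rewrite lt_min !ltr_norml => /andP[/andP[? ?] /andP[? ?]]; apply/andP; split; lra.
have rho_max : \forall s \near (0 : R), rho (p + s *: v) <= rho p.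
  have near_V : \forall s \near (0 : R), V (p + s *: v).
    by apply: near_line; exact: open_nbhs_nbhs.
  rewrite (defining_function_eq0 oO bp ldf).
  by near=> s; apply: (defining_function_le0 ldf); near: s.
have drho : \forall z \near p, derivable rho z v.
  by apply: (open_near oV Vp) => z; exact: smooth_derivable.
have gradE : \forall z \near p, dot v (grad rho z) = 'D_v rho z.
  by apply: (open_near oV Vp) => z Vz; rewrite deriveEgrad //; exact: smooth_differentiable Vz.
have vN : dot v (grad rho p) = 0 by rewrite (nbhs_singleton gradE) (derive_line_max drho).
have [d2rho D2rho] := near_eq_is_derive gradE (is_derive_dot_grad v v srho Vp).
have := tangent_hess_gt0 (curv _ bp) ldf v0 vN.
by rewrite dotC -D2rho ltNge derive2_line_max.
Unshelve. all: by end_near. Qed.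

End StrictlyConvexBoundary.

Section Visibility.
Variables (R : realType) (V : normedModType R).
Implicit Types (x y : V) (A : set V).

Lemma convex_setP A : convex_set (A : set (convex_lmodType V)) <->
  forall x y, A x -> A y -> forall t : R, 0 <= t <= 1 -> A (x + t *: (y - x)).
Proof.
have convE x y (t : {i01 R}) : conv t (y : convex_lmodType V) x = x + t%:num *: (y - x).
  by rewrite /conv /= scalerBl scale1r scalerBr addrCA.
split=> [cA x y Ax Ay t /andP[t0 t1]|cA y x t /set_mem Ay /set_mem Ax].
  by have := cA y x (Itv01 t0 t1) (mem_set Ay) (mem_set Ax); rewrite convE inE.
by rewrite convE inE; apply: cA => //; rewrite ge0 le1.
Qed.

Definition visible_from A x : set V :=
  [set y | forall t : R, 0 <= t <= 1 -> A (x + t *: (y - x))].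

Lemma open_visible_from A x : open A -> open (visible_from A x).
Proof.
move=> oA; rewrite openE => y yA; rewrite /interior.
have cover := (compact_near_coveringP _).1 (@segment_compact R 0 1).
have {}cover := cover _ (nbhs y) (fun y' t => A (x + t *: (y' - x))) (nbhs_filter y).
suff : \forall y' \near y, `[0, 1]%classic `<=` (fun t => A (x + t *: (y' - x))).
  by apply: filterS => y' A01 t t01; apply: A01; rewrite /= in_itv.
apply: cover.
move=> t; rewrite /= in_itv /= => /yA Ayt.
have cline : x + p.1 *: (p.2 - x) @[p --> (t, y)] --> x + t *: (y - x).
  apply: cvgD; first exact: cvg_cst.
  apply: cvgZ; first exact: cvg_fst.
  by apply: cvgB; [exact: cvg_snd | exact: cvg_cst].
exact: cline (open_nbhs_nbhs (conj oA Ayt)).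
Qed.

Lemma closure_visible_from A x y : closure (visible_from A x) y ->
  forall t : R, 0 <= t <= 1 -> closure A (x + t *: (y - x)).
Proof.
move=> cy t t01 B nB; have cline : x + t *: (z - x) @[z --> y] --> x + t *: (y - x).
  apply: cvgD; first exact: cvg_cst.
  by apply: cvgZl_tmp; apply: cvgB; [exact: cvg_id | exact: cvg_cst].
by have [z [/(_ t t01) Az Bz]] := cy _ (cline _ nB); exists (x + t *: (z - x)).
Qed.

End Visibility.

(* Tietze-Nakajima: the points visible from [x] form a relatively clopen set. *)
Lemma strictly_convex_boundary_convex (R : realType) (n : nat) (Omega : set 'rV[R]_n) :
  open Omega -> connected Omega -> smooth_strictly_convex_boundary Omega ->
  convex_set (Omega : set (convex_lmodType 'rV[R]_n)).
Proof.
move=> oO conO sb; apply/convex_setP => x y Ox Oy.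
suff visE : Omega `&` visible_from Omega x = Omega.
  by have [] : (Omega `&` visible_from Omega x) y by rewrite visE.
apply: conO.
- by exists x; split => // t _; rewrite subrr scaler0 addr0.
- by exists (visible_from Omega x) => //; exact: open_visible_from.
- exists (closure (visible_from Omega x)); first exact: closed_closure.
  apply/seteqP; split=> z [Oz vz]; split => //; first exact: subset_closure.
  move=> t /andP[t0 t1].
  have [<-|xz] := eqVneq x z; first by rewrite subrr scaler0 addr0.
  have [->|tn0] := eqVneq t 0; first by rewrite scale0r addr0.
  have [->|tn1] := eqVneq t 1; first by rewrite scale1r addrC subrK.
  apply: segment_interior => //; first by rewrite !lt_neqAle t0 t1 tn1 eq_sym tn0.
  exact: closure_visible_from.
Qed.

(** * The gradient map *)

Section CompactnessAndConnectedness.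
Variable R : realType.

Lemma compact_closed_ball (n : nat) (x : 'rV[R]_n) (r : R) : 0 < r -> compact (closed_ball x r).
Proof.
move=> r0; apply: bounded_closed_compact; last exact: closed_ball_closed.
exists (`|x| + r); split; first exact: num_real.
move=> M ltM y; rewrite closed_ballE // /closed_ball_ /= => xy.
apply: le_trans (ltW ltM); rewrite -[y](subKr x) (le_trans (ler_normB _ _)) //.
by rewrite lerD2l.
Qed.

(* The preimages of the neighborhoods of a limit value cluster at a preimage of that value. *)
Lemma closed_image_blowup (T : topologicalType) (W : normedModType R) (f : T -> W) (A : set T) :
  compact (closure A) -> {in A, continuous f} ->
  (forall p, closure A p -> ~ A p -> `|f x| @[x --> within A (nbhs p)] --> +oo) ->
  closed (f @` A).
Proof.
move=> cA cf blowup a cla; pose F := filter_from (nbhs a) (fun U => A `&` f @^-1` U).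
have FF : ProperFilter F.
  apply: filter_from_proper => [|U nU]; last by have [_ [[x Ax <-] Ux]] := cla U nU; exists x.
  apply: filter_from_filter => [|U U' nU nU']; first by exists setT; exact: filterT.
  by exists (U `&` U'); [exact: filterI | move=> x [Ax []]].
have FA U : nbhs a U -> F (A `&` f @^-1` U) by exists U.
have [x [cAx clx]] : closure A `&` cluster F !=set0.
  by apply: cA; exists setT; [exact: filterT | move=> y [/subset_closure]].
have [Ax|nAx] := pselect (A x).
  exists x => //; apply: (@norm_hausdorff _ W) => U U' nU nU'.
  have [y [[Ay U'y] Uy]] := clx _ _ (FA _ nU') (cf x (mem_set Ax) U nU).
  by exists (f y).
have := blowup x cAx nAx; move=> /cvgryPgt/(_ (`|a| + 1)); rewrite near_withinE => big.
have [y [[Ay]]] := clx _ _ (FA _ (nbhsx_ballx a _ ltr01)) big.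
rewrite -ball_normE /ball_ /= => ay /(_ Ay); rewrite ltNge => /negP[].
by rewrite -[f y](subKr a) (le_trans (ler_normB _ _)) // lerD2l ltW.
Qed.

Lemma bounded_closure (V : normedModType R) (A : set V) :
  bounded_set A -> bounded_set (closure A).
Proof.
move=> [M [Mreal AM]]; exists M; split=> // N MN x clx.
have : closed_ball_ Num.Def.normr 0 N x.
  have /closure_id -> := @closed_closed_ball_ _ _ (0 : V) N.
  by apply: closure_subset clx => y Ay; rewrite /closed_ball_ /= sub0r normrN AM.
by rewrite /closed_ball_ /= sub0r normrN.
Qed.

Lemma clopen_setT (V : normedModType R) (A : set V) : open A -> closed A -> A !=set0 -> A = setT.
Proof.
move=> oA cA [x Ax]; apply/seteqP; split=> // y _.
pose line := fun t : R => x + t *: (y - x).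
have cline : continuous line.
  by move=> t; apply: cvgD; [exact: cvg_cst | apply: cvgZr_tmp; exact: cvg_id].
have lineA : `[0, 1]%classic `&` (line @^-1` A) = `[0, 1]%classic.
  apply: (@segment_connected R 0 1).
  - by exists 0; rewrite /line /= in_itv /= lexx ler01 scale0r addr0.
  - by exists (line @^-1` A) => //; apply: open_comp => // t _; exact: cline.
  - by exists (line @^-1` A) => //; apply: closed_comp => // t _; exact: cline.
have : (`[0, 1]%classic `&` (line @^-1` A)) 1 by rewrite lineA /= in_itv /= ler01 lexx.
by rewrite /line /= => -[_]; rewrite scale1r addrCA subrr addr0.
Qed.

Lemma cvg_enorm_norm (n : nat) (T : Type) (F : set_system T) {FF : Filter F}
    (f : T -> 'rV[R]_n) :
  enorm (f t) @[t --> F] --> +oo -> `|f t| @[t --> F] --> +oo.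
Proof.
move=> /cvgryPgt fy; apply/cvgryPgt => M.
apply: filterS (fy (Num.sqrt n%:R * M)) => t lt; rewrite ltNge; apply/negP => fM.
by move: lt; rewrite ltNge (le_trans (enorm_le_norm _)) // ler_wpM2l ?sqrtr_ge0.
Qed.

End CompactnessAndConnectedness.

Section GradientMap.
Variables (R : realType) (n : nat) (Omega : set 'rV[R]_n) (u : 'rV[R]_n -> R).
Hypotheses (oO : open Omega) (cO : convex_set (Omega : set (convex_lmodType 'rV[R]_n))).
Hypotheses (su : smooth_on Omega u) (cu : strictly_convex_on Omega u).
Implicit Types (x y v a : 'rV[R]_n).

Lemma grad_strictly_monotone x y : Omega x -> Omega y -> x != y ->
  0 < dot (y - x) (grad u y - grad u x).
Proof.
move=> Ox Oy xy; have Oxy := (convex_setP _).1 cO x y Ox Oy; set v := y - x in Oxy *.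
have dgrad t : 0 <= t <= 1 -> is_derive (x + t *: v) v (fun z => dot v (grad u z))
    (dot v (v *m hess u (x + t *: v))).
  by move=> /Oxy; exact: is_derive_dot_grad.
have [t /dgrad[]//|t /andP[/ltW t0 /ltW t1]] :=
  @MVT_line _ _ (fun z => dot v (grad u z)) x v 1 ltr01.
have t01 : 0 <= t <= 1 by rewrite t0.
have [_ ->] := dgrad t t01; rewrite scale1r mul1r addrCA subrr addr0 => gradE.
by rewrite dotDr dotNr gradE dotC dotE; apply: cu; [exact: Oxy | rewrite subr_eq0 eq_sym].
Qed.

Lemma grad_injective x y : Omega x -> Omega y -> grad u x = grad u y -> x = y.
Proof.
move=> Ox Oy gradE; apply/eqP/negPn/negP => /(grad_strictly_monotone Ox Oy).
by rewrite gradE subrr dotC dot0l ltxx.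
Qed.

Lemma strictly_convex_gt_tangent x y : Omega x -> Omega y -> x != y ->
  u x + dot (y - x) (grad u x) < u y.
Proof.
move=> Ox Oy xy; have Oxy := (convex_setP _).1 cO x y Ox Oy; set v := y - x in Oxy *.
have [t /Oxy/(smooth_derivable su) //|t /andP[t0 t1]] := @MVT_line _ _ u x v 1 ltr01.
have t01 : 0 <= t <= 1 by rewrite !ltW.
rewrite scale1r mul1r addrCA subrr addr0 deriveEgrad; last first.
  exact: smooth_differentiable su (Oxy t t01).
move=> uE; rewrite addrC -ltrBrDr uE -subr_gt0 -dotNr -dotDr.
have xt : x != x + t *: v.
  by rewrite -subr_eq0 opprD addNKr oppr_eq0 scaler_eq0 (gt_eqF t0) subr_eq0 eq_sym.
have := grad_strictly_monotone Ox (Oxy t t01) xt.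
by rewrite addrAC subrr add0r dotZl pmulr_rgt0.
Qed.

(* Its supremum over [y] is the value at [a] of the Legendre transform of [u], and its critical
   points are the preimages of [a] under [grad u]. *)
Definition affine_gap a y : R := dot y a - u y.

Lemma continuous_affine_gap (T : topologicalType) (f g : T -> 'rV[R]_n) (t : T) :
  {for t, continuous f} -> {for t, continuous g} -> Omega (g t) ->
  {for t, continuous (fun s => affine_gap (f s) (g s))}.
Proof.
move=> cf cg Og; apply: continuousB; first exact: continuous_dot.
apply: continuous_comp => //.
exact: differentiable_continuous (smooth_differentiable su Og).
Qed.

Lemma affine_gap_lt x y : Omega x -> Omega y -> x != y ->
  affine_gap (grad u x) y < affine_gap (grad u x) x.
Proof.
move=> Ox Oy xy; have := strictly_convex_gt_tangent Ox Oy xy.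
by rewrite dotDl dotNl /affine_gap; lra.
Qed.

Lemma near_affine_gap_lt x y : Omega x -> Omega y -> x != y ->
  \forall z \near y & a \near grad u x, affine_gap a z < affine_gap a x.
Proof.
move=> Ox Oy xy; have := affine_gap_lt Ox Oy xy; rewrite -subr_gt0.
have cgap : {for (y, grad u x), continuous (fun p : 'rV[R]_n * 'rV[R]_n =>
    affine_gap p.2 x - affine_gap p.2 p.1)}.
  apply: continuousB.
    apply: (continuous_affine_gap (f := snd) (g := cst x)) Ox; first exact: cvg_snd.
    exact: cst_continuous.
  apply: (continuous_affine_gap (f := snd) (g := fst)); [exact: cvg_snd | exact: cvg_fst |].
  exact: Oy.
by move=> /(cvgr_gt _ cgap); apply: filterS => p /=; rewrite subr_gt0.
Qed.

Lemma grad_affine_gap_max a z : Omega z ->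
  (\forall y \near z, affine_gap a y <= affine_gap a z) -> grad u z = a.
Proof.
move=> Oz gap_max; have dgap y v : Omega y ->
    is_derive y v (affine_gap a) (dot v (a - grad u y)).
  move=> Oy; rewrite dotDr dotNr; apply: is_deriveB; last first.
    by split; [exact: smooth_derivable Oy | exact/deriveEgrad/(smooth_differentiable su)].
  apply: is_derive_eq; first by apply: is_derive_dot.
  by rewrite [X in _ + X]dotC dot0l addr0.
apply/esym/eqP; rewrite -subr_eq0 -dot_eq0; apply/eqP; set v := a - _.
have [_ <-] := dgap z v Oz; apply: derive_line_max (near_line v gap_max).
by apply: (open_near oO Oz) => y Oy; have [] := dgap y v Oy.
Qed.

(* For [a] close to [grad u x], the maximum of [affine_gap a] over a small closed ball around [x]
   is not attained on the sphere. *)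
Lemma grad_nbhs x (B : set 'rV[R]_n) : Omega x -> nbhs x B ->
  nbhs (grad u x) (grad u @` (Omega `&` B)).
Proof.
move=> Ox nB; have /nbhs_closedballP[r rOB] : nbhs x (Omega `&` B).
  by apply: filterI => //; exact: open_nbhs_nbhs.
set C := closed_ball x r%:num in rOB.
have cC : compact C by exact: compact_closed_ball.
have Cx : C x by exact: closed_ballxx.
have sphere_lt : \forall a \near grad u x,
    C `\` ball x r%:num `<=` (fun y => affine_gap a y < affine_gap a x).
  have cS : compact (C `\` ball x r%:num).
    apply: compact_closedI => //; exact: open_closedC (ball_open _ _).
  have cover := (compact_near_coveringP _).1 cS.
  apply: (cover _ (nbhs (grad u x)) (fun a y => affine_gap a y < affine_gap a x)) => y.
  move=> [/rOB[Oy _] nby].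
  apply: near_affine_gap_lt => //; apply: contra_not_neq nby => <-; exact: ballxx.
apply: filterS sphere_lt => a sphere_lt.
have [||z /set_mem Cz zmax] := @EVT_max_rV R n (affine_gap a) C _ cC; first by exists x.
  apply: continuous_in_subspaceT => y /set_mem/rOB[Oy _].
  by apply: continuous_affine_gap Oy; [exact: cst_continuous | exact: cvg_id].
exists z; first exact: rOB.
apply: grad_affine_gap_max; first by have [] := rOB z Cz.
have bz : ball x r%:num z.
  have [//|nbz] := pselect (ball x r%:num z).
  have := sphere_lt z (conj Cz nbz).
  by rewrite ltNge zmax // inE.
have : nbhs z (ball x r%:num) by apply: open_nbhs_nbhs; split => //; exact: ball_open.
by apply: filterS => y /subset_closed_ball Cy; apply: zmax; rewrite inE.
Qed.

Lemma open_grad_range : open (grad u @` Omega).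
Proof.
rewrite openE => _ [x Ox <-]; have := grad_nbhs Ox (open_nbhs_nbhs (conj oO Ox)).
by rewrite setIid.
Qed.

End GradientMap.

Section GradientOnto.
Variables (R : realType) (n : nat) (Omega : set 'rV[R]_n) (u : 'rV[R]_n -> R).
Hypotheses (oO : open Omega) (cO : convex_set (Omega : set (convex_lmodType 'rV[R]_n))).
Hypotheses (O0 : Omega !=set0) (bO : bounded_set Omega).
Hypotheses (su : smooth_on Omega u) (cu : strictly_convex_on Omega u).
Hypothesis blowup : forall p, boundary Omega p ->
  enorm (grad u xi) @[xi --> within Omega (nbhs p)] --> +oo.

Lemma closed_grad_range : closed (grad u @` Omega).
Proof.
apply: closed_image_blowup.
- by apply: bounded_closed_compact; [exact: bounded_closure | exact: closed_closure].
- move=> x /set_mem Ox; apply: differentiable_continuous.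
  exact: smooth_mx_differentiable (smooth_grad su) Ox.
- move=> p cOp nOp; apply: cvg_enorm_norm; apply: blowup.
  by split=> // /interior_subset.
Qed.

Lemma grad_onto : grad u @` Omega = [set: 'rV[R]_n].
Proof.
apply: clopen_setT; [exact: open_grad_range | exact: closed_grad_range |].
by have [x Ox] := O0; exists (grad u x), x.
Qed.

Lemma grad_inverse : exists G : 'rV[R]_n -> 'rV[R]_n,
  [/\ forall a, Omega (G a), forall a, grad u (G a) = a, forall x, Omega x -> G (grad u x) = x
    & continuous G].
Proof.
have onto a : exists x, Omega x /\ grad u x = a.
  by have [x Ox <-] : (grad u @` Omega) a; [rewrite grad_onto | exists x].
pose G a := sval (cid (onto a)); have OG a : Omega (G a) /\ grad u (G a) = a.
  exact: svalP (cid (onto a)).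
have GK x : Omega x -> G (grad u x) = x.
  by move=> Ox; have [OGx] := OG (grad u x); exact: (grad_injective cO su cu).
exists G; split=> [a|a|//|a B nB]; try by have [] := OG a.
have [Oa Ga] := OG a; have := grad_nbhs oO cO su cu Oa nB; rewrite Ga.
by apply: filterS => _ [y [Oy By] <-]; rewrite /= GK.
Qed.

End GradientOnto.

(** * The Legendre transform *)

Section InverseDifferential.
Variables (R : realType) (V W : normedModType R).

Lemma is_diff_inverse (f : V -> W) (g : W -> V) (b : W) (L : {linear W -> V}) :
  continuous L -> {for b, continuous g} -> (\forall y \near b, f (g y) = y) ->
  differentiable f (g b) -> cancel ('d f (g b)) L -> is_diff b g L.
Proof.
move=> cL cg fgK df dfK; have [C C0 LC] := linear_lipschitz cL.
have fgb : f (g b) = b := nbhs_singleton fgK.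
pose k h := g (h + b) - g b.
have k_remainder e : 0 < e ->
    \forall h \near (0 : W), `|h - 'd f (g b) (k h)| <= e * `|k h|.
  move=> e0; have k0 : k h @[h --> (0 : W)] --> (0 : V).
    rewrite [X in _ --> X](_ : _ = k 0); last by rewrite /k add0r subrr.
    apply: continuousB; last exact: cst_continuous.
    apply: (continuous_comp (f := +%R^~ b)); last by rewrite /= add0r.
    by apply: continuousD; [exact: cvg_id | exact: cst_continuous].
  have /eqaddoP/(_ e e0)/k0 := diff_locally df.
  move: fgK; rewrite (near_shift 0) /= subr0; apply: filterS2 => h /= fgh.
  rewrite -![(_ + _ : _ -> _) _]/(_ + _) -![(- _ : _ -> _) _]/(- _) /= /k subrK.
  by rewrite /shift /= in fgh; rewrite fgh fgb opprD addrA addrK.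
have gE : g \o shift b = cst (g b) + L +o_ (0 : W) id.
  apply/eqaddoP => e e0; pose e' := Num.min (2^-1 / C) (e / (2 * C * C)).
  have e'0 : 0 < e' by rewrite lt_min !divr_gt0 ?mulr_gt0.
  apply: filterS (k_remainder e' e'0) => h rk.
  rewrite -![(_ + _ : _ -> _) _]/(_ + _) -![(- _ : _ -> _) _]/(- _) /= opprD addrA -/(k h).
  have kE : k h - L h = - L (h - 'd f (g b) (k h)) by rewrite linearB dfK opprB.
  have Lr : `|k h - L h| <= C * e' * `|k h|.
    by rewrite kE normrN (le_trans (LC _)) // -mulrA ler_wpM2l // ltW.
  have kh : `|k h| <= 2 * C * `|h|.
    have Ce' : C * e' * `|k h| <= 2^-1 * `|k h|.
      by rewrite ler_wpM2r // mulrC -ler_pdivlMr // ge_min lexx.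
    have : `|k h| <= `|k h - L h| + `|L h| by rewrite -[X in `|X| <= _](subrK (L h)) ler_normD.
    by have := LC h; lra.
  rewrite (le_trans Lr) // (le_trans (y := C * e' * (2 * C * `|h|))) //.
    by rewrite ler_wpM2l // mulr_ge0 // ltW.
  rewrite (_ : C * e' * _ = e' * (2 * C * C) * `|h|); last by ring.
  by rewrite ler_wpM2r // -ler_pdivlMr ?mulr_gt0 // ge_min lexx orbT.
have dgE := diff_unique cL gE.
by apply: DiffDef => //; apply/diff_locallyP; rewrite dgE.
Qed.

End InverseDifferential.

Definition inv_hess (R : realType) (n : nat) (u : 'rV[R]_n -> R) (y : 'rV[R]_n) : 'M[R]_n :=
  invmx (hess u y).

Section InverseGradient.
Variables (R : realType) (n : nat) (Omega : set 'rV[R]_n) (u : 'rV[R]_n -> R).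
Hypotheses (oO : open Omega) (su : smooth_on Omega u).
Hypothesis (hess_unitmx : forall y, Omega y -> hess u y \in unitmx).
Variable G : 'rV[R]_n -> 'rV[R]_n.
Hypotheses (GO : forall a, Omega (G a)) (gradG : forall a, grad u (G a) = a).
Hypothesis (cG : continuous G).
Implicit Types (a v : 'rV[R]_n) (phi : 'rV[R]_n -> R).

Lemma is_diff_inverse_grad a : is_diff a G (mulmxr (inv_hess u (G a))).
Proof.
have dgrad := smooth_mx_differentiable (smooth_grad su) (GO a).
apply: (is_diff_inverse (f := grad u)) => //.
- exact: linear_rV_continuous.
- exact: cG.
- by near=> b; exact: gradG.
- move=> v; rewrite -deriveE //; have [_ ->] := is_derive_grad v su (GO a).
  by rewrite /= mulmxK // hess_unitmx.
Unshelve. all: by end_near. Qed.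

Lemma is_derive_inverse_grad a v : is_derive a v G (v *m inv_hess u (G a)).
Proof.
have [dG dGE] := is_diff_inverse_grad a.
by split; [exact: diff_derivable | rewrite deriveE // dGE].
Qed.

Lemma is_derive_comp_inverse_grad phi a v : smooth_on Omega phi ->
  is_derive a v (fun b => phi (G b)) (dot (v *m inv_hess u (G a)) (grad phi (G a))).
Proof.
move=> sphi; have dphi := smooth_differentiable sphi (GO a).
have [dG dGE] := is_diff_inverse_grad a.
have dphiG : differentiable (phi \o G) a by exact: differentiable_comp.
split; first exact: diff_derivable.
by rewrite [LHS]deriveE // diff_comp //= dGE -deriveE // deriveEgrad.
Qed.

Lemma partial_comp_inverse_grad phi a k : smooth_on Omega phi ->
  partial k (fun b => phi (G b)) a = dot (row k (inv_hess u (G a))) (grad phi (G a)).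
Proof. by move=> sphi; rewrite rowE; apply/derive_val/is_derive_comp_inverse_grad. Qed.

Lemma smooth_inv_hess : smooth_mx_on Omega (inv_hess u).
Proof. exact: smooth_invmx (smooth_hess su) hess_unitmx. Qed.

Lemma smooth_comp_inverse_grad phi : smooth_on Omega phi -> smooth_on setT (fun a => phi (G a)).
Proof.
move=> sphi; apply: (smooth_on_coind (P := fun f => exists2 phi, smooth_on Omega phi &
  f = fun a => phi (G a))); [exact: openT | | by exists phi].
move=> _ [psi spsi ->]; split=> [a _|k].
  apply: (differentiable_comp (g := psi)); last exact: smooth_differentiable spsi _.
  by have [] := is_diff_inverse_grad a.
pose dpsi y := dot (row k (inv_hess u y)) (grad psi y).
exists (fun a => dpsi (G a)) => [|a _]; last exact: partial_comp_inverse_grad.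
exists dpsi => //; apply: smooth_dot => //; last exact: smooth_grad.
move=> i j; rewrite (_ : (fun _ => _) = fun y => inv_hess u y k j); first exact: smooth_inv_hess.
by apply/funext => y; rewrite mxE.
Qed.

Lemma smooth_inverse_grad : smooth_mx_on setT G.
Proof.
by move=> i j; apply: (smooth_comp_inverse_grad (phi := fun y => y i j)); exact: smooth_mx_id.
Qed.

End InverseGradient.

Lemma derive_hessE (R : realType) (n : nat) (U : set 'rV[R]_n) (u : 'rV[R]_n -> R) x v i j :
  smooth_on U u -> U x -> ('D_v (hess u) x) i j = 'D_v (partial i (partial j u)) x.
Proof.
by move=> su /(smooth_mx_derivable (v := v) (smooth_hess su))/derive_mx ->; rewrite mxE hess_coord.
Qed.

Definition log_det_hess (R : realType) (n : nat) (u : 'rV[R]_n -> R) (y : 'rV[R]_n) : R :=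
  ln (\det (hess u y)).

Section LogDetHessian.
Variables (R : realType) (n : nat) (Omega : set 'rV[R]_n) (u : 'rV[R]_n -> R).
Hypotheses (oO : open Omega) (su : smooth_on Omega u) (cu : strictly_convex_on Omega u).
Implicit Types (v y : 'rV[R]_n).

Lemma hess_unitmx y : Omega y -> hess u y \in unitmx.
Proof. by move=> Oy; apply: posdef_unitmx; exact: cu. Qed.

Lemma det_hess_gt0 y : Omega y -> 0 < \det (hess u y).
Proof. by move=> Oy; apply: posdef_det_gt0; exact: cu. Qed.

Lemma smooth_log_det_hess : smooth_on Omega (log_det_hess u).
Proof.
by apply: smooth_ln => //; [exact: det_hess_gt0 | exact/smooth_det/smooth_hess].
Qed.

Lemma derive_log_det_hess y v : Omega y ->
  'D_v (log_det_hess u) y = \tr (inv_hess u y *m 'D_v (hess u) y).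
Proof.
move=> Oy; have dH := derivableP (smooth_mx_derivable (v := v) (smooth_hess su) Oy).
have [_ ->] := is_derive_ln (f := fun z => \det (hess u z)) (det_hess_gt0 Oy) (is_derive_det dH).
by rewrite /inv_hess /invmx hess_unitmx // -scalemxAl mxtraceZ.
Qed.

Lemma derive_inv_hess y v : Omega y ->
  'D_v (inv_hess u) y = - (inv_hess u y *m 'D_v (hess u) y *m inv_hess u y).
Proof.
move=> Oy; apply: derive_invmx; first exact: (open_near oO Oy hess_unitmx).
  exact: smooth_mx_derivable (smooth_hess su) Oy.
exact: smooth_mx_derivable (smooth_inv_hess oO su hess_unitmx) Oy.
Qed.

Lemma derive_hessC i j k y : Omega y ->
  ('D_(delta_mx 0 i) (hess u) y) j k = ('D_(delta_mx 0 j) (hess u) y) i k.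
Proof.
move=> Oy; transitivity (partial i (partial j (partial k u)) y); first exact: derive_hessE su Oy.
transitivity (partial j (partial i (partial k u)) y); last exact/esym/(derive_hessE _ _ _ su Oy).
exact: partialC oO (smooth_partial k su) Oy.
Qed.

(* Jacobi's formula and the total symmetry of the third derivatives of [u]. *)
Lemma div_inv_hess j y : Omega y ->
  \sum_k partial k (fun z => inv_hess u z j k) y =
  - dot (row j (inv_hess u y)) (grad (log_det_hess u) y).
Proof.
move=> Oy; pose DH k := 'D_(delta_mx 0 k) (hess u) y; set I := inv_hess u y.
have DI k : partial k (fun z => inv_hess u z j k) y = - (I *m (DH k *m I)) j k.
  have dI := smooth_mx_derivable (v := delta_mx 0 k) (smooth_inv_hess oO su hess_unitmx) Oy.
  have /is_derive_mxP/(_ j k)[_] := derivableP dI.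
  by rewrite derive_inv_hess // -mulmxA mxE.
have trace a : \sum_k (DH k *m I) a k = partial a (log_det_hess u) y.
  rewrite [RHS]derive_log_det_hess // mxtrace_mulC; apply: eq_bigr => k _.
  rewrite [LHS]mxE [RHS]mxE; apply: eq_bigr => b _; congr (_ * _); exact: derive_hessC.
under eq_bigr do rewrite DI mxE.
rewrite sumrN exchange_big; congr (- _); apply: eq_bigr => a _ /=.
by rewrite -mulr_sumr trace !mxE.
Qed.

End LogDetHessian.

Section LegendreTransform.
Variables (R : realType) (n : nat) (Omega : set 'rV[R]_n) (u : 'rV[R]_n -> R).
Hypotheses (oO : open Omega) (su : smooth_on Omega u) (cu : strictly_convex_on Omega u).
Variable G : 'rV[R]_n -> 'rV[R]_n.
Hypotheses (GO : forall a, Omega (G a)) (gradG : forall a, grad u (G a) = a).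
Hypotheses (GK : forall x, Omega x -> G (grad u x) = x) (cG : continuous G).
Implicit Types (a v y : 'rV[R]_n).

Local Notation f := (legendre Omega u).

Let is_derive_G := is_derive_inverse_grad su (hess_unitmx cu) GO gradG cG.
Let is_derive_comp_G := is_derive_comp_inverse_grad su (hess_unitmx cu) GO gradG cG.

Lemma legendreE a : f a = dot (G a) a - u (G a).
Proof.
rewrite /legendre; set legendre_values := [set _ | _].
have [|xi [Oxi gradxi ->]] := @xgetPex _ 0 legendre_values.
  by exists (dot (G a) a - u (G a)), (G a).
by have <- : G a = xi by rewrite -gradxi GK.
Qed.

Lemma smooth_legendre : smooth_on setT f.
Proof.
rewrite (_ : f = fun a => dot (G a) a - u (G a)); last exact/funext/legendreE.
apply: smoothB; first exact: openT.
  apply: smooth_dot; [exact: openT | | exact: smooth_mx_id openT].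
  exact: (smooth_inverse_grad oO su (hess_unitmx cu) GO gradG cG).
exact: (smooth_comp_inverse_grad oO su (hess_unitmx cu) GO gradG cG).
Qed.

(* The derivative of [G] cancels since [grad u (G a) = a]. *)
Lemma grad_legendre : grad f = G.
Proof.
apply/funext => a; apply/rowP => i; rewrite mxE -[RHS]dot_delta; apply: derive_val.
rewrite (_ : f = fun a => dot (G a) a - u (G a)); last exact/funext/legendreE.
apply: is_derive_eq.
  exact: is_deriveB (is_derive_dot (is_derive_G _ _) (is_derive_id _ _)) (is_derive_comp_G _ _ su).
by rewrite gradG addrAC subrr add0r dotC.
Qed.

Lemma hess_legendre a : hess f a = inv_hess u (G a).
Proof.
apply/matrixP => i j; rewrite mxE -(grad_coord _ j) grad_legendre.
have /is_derive_mxP/(_ 0 j)[_] := is_derive_G a (delta_mx 0 i).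
by rewrite -rowE mxE.
Qed.

Lemma strictly_convex_legendre : strictly_convex_on setT f.
Proof.
move=> a _; have Oa := GO a; rewrite hess_legendre.
by apply: posdef_invmx; [exact: hess_sym oO su Oa | exact: cu].
Qed.

Lemma log_det_hess_legendre : log_det_hess f = fun a => - log_det_hess u (G a).
Proof.
apply/funext => a; rewrite /log_det_hess hess_legendre det_inv lnV // posrE.
exact/(det_hess_gt0 cu)/GO.
Qed.

Lemma partial_log_det_hess_legendre j :
  partial j (log_det_hess f) = fun a => \sum_k partial k (fun y => inv_hess u y j k) (G a).
Proof.
apply/funext => a; rewrite (div_inv_hess oO su cu) // rowE; apply: derive_val.
rewrite log_det_hess_legendre; apply: is_deriveN; apply: is_derive_comp_G.
exact: smooth_log_det_hess.
Qed.

Lemma hess_partial_comp_inverse_grad phi j a : smooth_on Omega phi ->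
  \sum_i hess u (G a) j i * partial i (fun b => phi (G b)) a = partial j phi (G a).
Proof.
move=> sphi; have dphi v := is_derive_comp_G a v sphi.
transitivity ('D_(row j (hess u (G a))) (fun b => phi (G b)) a).
  rewrite deriveEgrad; first by apply: eq_bigr => i _; rewrite !mxE.
  apply: (@smooth_differentiable _ _ setT) => //.
  exact: (smooth_comp_inverse_grad oO su (hess_unitmx cu) GO gradG cG).
have [_ ->] := dphi (row j (hess u (G a))).
rewrite rowE -mulmxA mulmxV ?mulmx1 ?dot_delta ?mxE //.
exact/(hess_unitmx cu)/GO.
Qed.

Lemma abreu_legendre a :
  - \sum_i \sum_j invmx (hess f a) j i * partial i (partial j (log_det_hess f)) a =
  abreu u (G a).
Proof.
congr (- _); rewrite exchange_big /=; apply: eq_bigr => j _.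
pose div_j y := \sum_k partial k (fun z => inv_hess u z j k) y.
have spI k : smooth_on Omega (partial k (fun z => inv_hess u z j k)).
  by apply: smooth_partial; exact: (smooth_inv_hess oO su (hess_unitmx cu)).
have sdiv : smooth_on Omega div_j by exact: smooth_bigsum.
rewrite hess_legendre invmxK partial_log_det_hess_legendre.
rewrite (hess_partial_comp_inverse_grad _ _ sdiv); apply: derive_val.
apply: is_derive_bigsum => k _; apply: derivableP.
exact: smooth_derivable (spI k) (GO a).
Qed.

End LegendreTransform.

(** * Torus-invariant metrics *)

Section RealPartDerivatives.
Variables (R : realType) (n : nat).
Implicit Types (h : 'rV[R]_n -> R) (z w : 'rV[R]_(n + n)) (i j k : 'I_n).

Lemma partial_lsubmx h z (k : 'I_(n + n)) :
  partial k (fun w => h (lsubmx w)) z =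
    if fintype.split k is inl k' then partial k' h (lsubmx z) else 0.
Proof.
have lsubmx_delta : lsubmx (delta_mx 0 k : 'rV[R]_(n + n)) =
    if fintype.split k is inl k' then delta_mx 0 k' else 0.
  case: splitP => k' kk'; apply/rowP => l; rewrite !mxE -!val_eqE /= kk' //.
  by rewrite ltn_eqF ?andbF // (leq_trans (ltn_ord l)) ?leq_addr.
have -> : partial k (fun w => h (lsubmx w)) z =
    'D_(lsubmx (delta_mx 0 k : 'rV[R]_(n + n))) h (lsubmx z).
  by apply: eq_line_derive => t; rewrite linearD linearZ.
by rewrite lsubmx_delta; case: splitP => // k' _; rewrite derive0.
Qed.

Lemma smooth_lsubmx h : smooth_on setT h ->
  smooth_on setT (fun w : 'rV[R]_(n + n) => h (lsubmx w)).
Proof.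
move=> sh; apply: (smooth_on_coind (P := fun F => exists2 h, smooth_on setT h &
  F = fun w => h (lsubmx w))); [exact: openT | | by exists h].
move=> _ [{}h {}sh ->]; split=> [w _|k].
  apply: (differentiable_comp (g := h)); first exact: differentiable_lsubmx.
  exact: smooth_differentiable sh _.
pose dh := if fintype.split k is inl k' then partial k' h else fun=> 0.
exists (fun w => dh (lsubmx w)) => [|w _]; last by rewrite partial_lsubmx /dh; case: splitP.
exists dh => //; rewrite /dh; case: splitP => k' _; first exact: smooth_partial.
exact: smooth_cst openT.
Qed.

Lemma cpartial_lshift_lsubmx h k z :
  cpartial (lshift n k) (fun w => (h (lsubmx w))%:C) z = (partial k h (lsubmx z))%:C.
Proof.
by rewrite /cpartial /= [X in _ +i* X]derive_cst partial_lsubmx (unsplitK (inl k)).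
Qed.

Lemma cpartial_rshift_lsubmx h k z :
  cpartial (rshift n k) (fun w => (h (lsubmx w))%:C) z = 0.
Proof.
by rewrite /cpartial /= [X in _ +i* X]derive_cst partial_lsubmx (unsplitK (inr k)).
Qed.

Lemma half_real_complex (x : R) : 2^-1 * x%:C = (2^-1 * x)%:C :> R[i].
Proof. by rewrite rmorphM /= fmorphV rmorph_nat. Qed.

Lemma dz_lsubmx h k z :
  dz k (fun w => (h (lsubmx w))%:C) z = (2^-1 * partial k h (lsubmx z))%:C.
Proof.
by rewrite /dz cpartial_lshift_lsubmx cpartial_rshift_lsubmx mulr0 subr0 half_real_complex.
Qed.

Lemma dzbar_lsubmx h k z :
  dzbar k (fun w => (h (lsubmx w))%:C) z = (2^-1 * partial k h (lsubmx z))%:C.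
Proof.
by rewrite /dzbar cpartial_lshift_lsubmx cpartial_rshift_lsubmx mulr0 addr0 half_real_complex.
Qed.

Lemma partialZ c h k (x : 'rV[R]_n) : differentiable h x ->
  partial k (fun y => c * h y) x = c * partial k h x.
Proof. by move=> dh; apply: deriveZ; exact: diff_derivable. Qed.

Lemma dz_dzbar_lsubmx h i j z : (forall x, differentiable (partial j h) x) ->
  dz i (dzbar j (fun w => (h (lsubmx w))%:C)) z =
  (4^-1 * partial i (partial j h) (lsubmx z))%:C.
Proof.
move=> dh; rewrite (_ : dzbar j _ = fun w => ((fun x => 2^-1 * partial j h x) (lsubmx w))%:C).
  by rewrite (dz_lsubmx (fun x => 2^-1 * partial j h x)) partialZ // mulrA -invfM -natrM.
by apply/funext => w; exact: dzbar_lsubmx.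
Qed.

End RealPartDerivatives.

(* For [v = a + i b], the Hermitian form of a real symmetric matrix at [v] is the sum of its
   values at [a] and [b]. *)
Lemma posdef_hermitian (R : realType) (n : nat) (A : 'M[R]_n) (v : 'rV[R[i]]_n) :
  A^T = A -> posdef A -> v != 0 ->
  0 < (v *m map_mx (real_complex R) A *m (map_mx Num.conj v)^T) 0 0.
Proof.
move=> AT pA v0.
pose a := \row_j complex.Re (v 0 j); pose b := \row_j complex.Im (v 0 j).
have vE : v = map_mx (real_complex R) a + 'i%C *: map_mx (real_complex R) b.
  by apply/rowP => j; rewrite !mxE -complexE.
have conj_vE : map_mx Num.conj v =
    map_mx (real_complex R) a - 'i%C *: map_mx (real_complex R) b.
  apply/rowP => j; rewrite !mxE; case: (v 0 j) => x y.
  by apply/eqP; rewrite eq_complex /=; apply/andP; split; apply/eqP; rewrite /=; ring.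
have form_ge0 (x : 'rV[R]_n) : 0 <= (x *m A *m x^T) 0 0.
  by have [->|/pA/ltW//] := eqVneq x 0; rewrite !mul0mx mxE.
have form_gt0 : 0 < (a *m A *m a^T) 0 0 + (b *m A *m b^T) 0 0.
  have [a0|a0] := eqVneq a 0; last by rewrite ltr_pwDl // pA.
  have [b0|b0] := eqVneq b 0; last by rewrite ltr_wpDl // pA.
  by move: v0; rewrite vE a0 b0 !map_mx0 scaler0 addr0 eqxx.
have form_sym : b *m A *m a^T = a *m A *m b^T.
  have -> : b *m A *m a^T = (a *m A *m b^T)^T by rewrite !trmx_mul trmxK AT mulmxA.
  by apply/matrixP => p q; rewrite mxE (ord1 p) (ord1 q).
rewrite conj_vE vE linearB linearZ /= !map_trmx mulmxDl mulmxBr !mulmxDl.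
rewrite -!scalemxAl -!scalemxAr -!map_mxM /= form_sym scalerA -expr2 sqr_i scaleN1r.
rewrite opprB addrA addrAC addrK.
by rewrite -map_mxD mxE ltcR mxE.
Qed.

Section PotentialMetric.
Variables (R : realType) (n : nat) (h : 'rV[R]_n -> R).
Hypothesis sh : smooth_on setT h.
Implicit Types (z : 'rV[R]_(n + n)) (i j k : 'I_n) (x : 'rV[R]_n).

Lemma potential_metricE z :
  potential_metric h z = map_mx (real_complex R) (4^-1 *: hess h (lsubmx z)).
Proof.
apply/matrixP => i j; rewrite !mxE dz_dzbar_lsubmx // => x.
exact: smooth_differentiable (smooth_partial j sh) _.
Qed.

Lemma potential_metric_coord i j : (fun z => potential_metric h z i j) =
  fun z => ((fun x => 4^-1 * partial i (partial j h) x) (lsubmx z))%:C.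
Proof. by apply/funext => z; rewrite potential_metricE !mxE. Qed.

Lemma hess_symT x : (hess h x)^T = hess h x.
Proof. exact: hess_sym openT sh _. Qed.

Lemma csmooth_potential_metric i j : csmooth (fun z => potential_metric h z i j).
Proof.
rewrite potential_metric_coord; split; last exact: smooth_cst openT.
apply: (smooth_lsubmx (h := fun x => 4^-1 * partial i (partial j h) x)).
by apply: smoothM; [exact: openT | exact: smooth_cst openT | do 2!apply: smooth_partial].
Qed.

Lemma torus_invariant_potential_metric : torus_invariant (potential_metric h).
Proof.
by move=> z t; rewrite (potential_metricE z) potential_metricE linearD /= row_mxKl addr0.
Qed.

Lemma potential_metric_hermitian z :
  (map_mx Num.conj (potential_metric h z))^T = potential_metric h z.
Proof.
rewrite potential_metricE -[in RHS](hess_symT (lsubmx z)); apply/matrixP => i j.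
by rewrite !mxE; exact: conjc_real.
Qed.

Lemma dz_potential_metric z i j k :
  dz k (fun w => potential_metric h w i j) z = dz i (fun w => potential_metric h w k j) z.
Proof.
have spj := smooth_partial j sh.
have dzE l m : dz l (fun w => potential_metric h w m j) z =
    (2^-1 * (4^-1 * partial l (partial m (partial j h)) (lsubmx z)))%:C.
  rewrite potential_metric_coord (dz_lsubmx (fun x => 4^-1 * partial m (partial j h) x)).
  by rewrite partialZ //; exact: smooth_differentiable (smooth_partial m spj) _.
by rewrite (dzE k i) (dzE i k) (partialC k i openT spj).
Qed.

Lemma dzbar_potential_metric z i j k :
  dzbar k (fun w => potential_metric h w i j) z = dzbar j (fun w => potential_metric h w i k) z.
Proof.
have potential_metricC p q :
    (fun w => potential_metric h w p q) = fun w => potential_metric h w q p.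
  rewrite (potential_metric_coord p q) (potential_metric_coord q p).
  by apply/funext => w /=; rewrite (partialC p q openT sh).
have dzbarE l p q : dzbar l (fun w => potential_metric h w p q) z =
    dz l (fun w => potential_metric h w p q) z.
  rewrite potential_metric_coord (dzbar_lsubmx (fun x => 4^-1 * partial p (partial q h) x)).
  by rewrite (dz_lsubmx (fun x => 4^-1 * partial p (partial q h) x)).
rewrite (dzbarE k i j) (dzbarE j i k) (potential_metricC i j) (potential_metricC i k).
exact: dz_potential_metric.
Qed.

Hypothesis ch : strictly_convex_on setT h.

Lemma potential_metric_posdef z (v : 'rV[R[i]]_n) : v != 0 ->
  0 < (v *m potential_metric h z *m (map_mx Num.conj v)^T) 0 0.
Proof.
rewrite potential_metricE; apply: posdef_hermitian; first by rewrite linearZ /= hess_symT.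
by apply: posdefZ; [rewrite invr_gt0 ltr0n | exact: ch].
Qed.

Lemma kahler_potential_metric : kahler_metric_torus (potential_metric h).
Proof.
split; first exact: csmooth_potential_metric.
split; first by move=> z m; exact: torus_invariant_potential_metric.
split; first exact: potential_metric_hermitian.
split; first exact: potential_metric_posdef.
by split; [exact: dz_potential_metric | exact: dzbar_potential_metric].
Qed.

Lemma ln_det_potential_metric z : ln (complex.Re (\det (potential_metric h z))) =
  ln (4^-1 ^+ n) + log_det_hess h (lsubmx z).
Proof.
have quarter_gt0 : (0 : R) < 4^-1 ^+ n by rewrite exprn_gt0 // invr_gt0.
rewrite potential_metricE det_map_mx /= detZ lnM // posrE //.
exact: (det_hess_gt0 ch).
Qed.

Lemma scalar_curvature_potential_metric z :
  scalar_curvature (potential_metric h) z =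
  (- \sum_i \sum_j invmx (hess h (lsubmx z)) j i *
     partial i (partial j (log_det_hess h)) (lsubmx z))%:C.
Proof.
have sl : smooth_on setT (log_det_hess h) by exact: smooth_log_det_hess openT sh ch.
pose l x := ln (4^-1 ^+ n) + log_det_hess h x.
have pl j : partial j l = partial j (log_det_hess h).
  apply/funext => x; have dl : derivable (log_det_hess h) x (delta_mx 0 j).
    exact: smooth_derivable sl _.
  by rewrite /partial (deriveD (derivable_cst _ _ _) dl) derive_cst add0r.
rewrite /scalar_curvature (_ : (fun w => (ln _)%:C) = fun w => (l (lsubmx w))%:C); last first.
  by apply/funext => w; rewrite ln_det_potential_metric.
rewrite rmorphN rmorph_sum; congr (- _); apply: eq_bigr => i _.
rewrite rmorph_sum; apply: eq_bigr => j _.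
rewrite dz_dzbar_lsubmx pl; last by move=> x; exact: smooth_differentiable (smooth_partial j sl) _.
have uH : 4^-1 *: hess h (lsubmx z) \in unitmx.
  by rewrite unitmxZ ?unitfE ?invr_eq0 ?pnatr_eq0 // (hess_unitmx ch).
rewrite potential_metricE -map_invmx invmxZ // !mxE -rmorphM /= invrK; congr (real_complex _ _).
by rewrite mulrACA divff ?mul1r // pnatr_eq0.
Qed.

End PotentialMetric.

Theorem corollary1p3 (R : realType) (n : nat) (Omega : set 'rV[R]_n)
  (hOmega : bounded_domain Omega)
  (hbd : smooth_strictly_convex_boundary Omega)
  (UK : set 'rV[R]_n) (K : 'rV[R]_n -> R) (ko : R)
  (hUK : open UK) (hUKOmega : closure Omega `<=` UK)
  (hK : smooth_on UK K) (hko : 0 < ko) (hKko : forall xi, UK xi -> ko <= K xi)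
  (Uphi : set 'rV[R]_n) (phi : 'rV[R]_n -> R)
  (hUphi : open Uphi) (hUphiOmega : closure Omega `<=` Uphi)
  (hphi : smooth_on Uphi phi) (hphic : strictly_convex_on Uphi phi)
  (u : 'rV[R]_n -> R)
  (hu : smooth_on Omega u) (huc : strictly_convex_on Omega u)
  (habreu : forall xi, Omega xi -> abreu u xi = K xi)
  (hbu : forall p, boundary Omega p ->
     u xi @[xi --> within Omega (nbhs p)] --> phi p)
  (hbgrad : forall p, boundary Omega p ->
     enorm (grad u xi) @[xi --> within Omega (nbhs p)] --> +oo)
  (hbdet : forall p, boundary Omega p ->
     (\det (hess u xi))^-1 @[xi --> within Omega (nbhs p)] --> (0 : R)) :
  let f := legendre Omega u in
  let g := potential_metric f in
  (* f is well defined by the Legendre formula, on all of R^n *)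
  [/\ grad u @` Omega = [set: 'rV[R]_n],
      (forall xi, Omega xi -> f (grad u xi) = dot xi (grad u xi) - u xi),
      smooth_on [set: 'rV[R]_n] f
    & kahler_metric_torus g] /\
  (forall xi z, Omega xi -> lsubmx z = grad u xi ->
     scalar_curvature g z = (K xi)%:C) /\
  (forall c : R, (forall xi, UK xi -> K xi = c) ->
     [/\ kahler_metric_torus g, torus_invariant g
       & forall z, scalar_curvature g z = c%:C]).
Proof.
have [oO conO O0 bO] := hOmega.
have cO := strictly_convex_boundary_convex oO conO hbd.
have [G [GO gradG GK cG]] := grad_inverse oO cO O0 bO hu huc hbgrad.
move=> f g.
have sf : smooth_on setT f := smooth_legendre oO hu huc GO gradG GK cG.
have cf : strictly_convex_on setT f := strictly_convex_legendre oO hu huc GO gradG GK cG.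
have kg : kahler_metric_torus g := kahler_potential_metric sf cf.
have curvature z : scalar_curvature g z = (K (G (lsubmx z)))%:C.
  by rewrite scalar_curvature_potential_metric // (abreu_legendre oO hu huc GO gradG GK cG) habreu.
split.
  split=> //; first exact: grad_onto.
  by move=> xi Oxi; rewrite /f (legendreE GO gradG GK) GK.
split=> [xi z Oxi zE|c Kc]; first by rewrite curvature zE GK.
split; [exact: kg | exact: torus_invariant_potential_metric sf | move=> z].
by rewrite curvature Kc //; exact/hUKOmega/subset_closure/GO.
Qed.
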